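(* Let $f=\frac1n\sum_{i=1}^n f_i$ with $f_i:\mathbb{R}^d\to\mathbb{R}$ differentiable. Suppose that $f$ is $L$-smooth, each $f_i$ is $L_i$-smooth with $L_{\max}=\max_iL_i$, each $f_i$ is convex, and $f$ attains a minimum at some $x^*\in\mathbb{R}^d$ (general convex case: strong convexity parameter $\mu=0$). Run the algorithm EF21-P + DIANA (described in the context) with compressors $\mathcal{C}_i^D\in\mathbb{U}(\omega)$, $\mathcal{C}^P\in\mathbb{B}(\alpha)$, $\beta=\frac1{\omega+1}$, $x^0=w^0$, arbitrary $h_1^0,\dots,h_n^0\in\mathbb{R}^d$, and $\gamma>0$ satisfying $$\gamma\le\min\left\{\frac{n}{160\,\omega L_{\max}},\ \frac{\alpha}{100L}\right\}.$$ Then for every $T\ge1$, $$\mathrm{E}\left[f\left(\frac1T\sum_{t=1}^Tx^t\right)\right]-f(x^* )\le\frac1{\gamma T}\|x^0-x^*\|^2+\frac{f(x^0)-f(x^* )}{T}+\frac{16\gamma\omega(\omega+1)}{Tn^2}\sum_{i=1}^n\|h_i^0-\nabla f_i(x^* )\|^2 .$$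
   Context: $\|\cdot\|$ is the Euclidean norm. A function is $L$-smooth if it is differentiable with $\|\nabla f(x)-\nabla f(y)\|\le L\|x-y\|$ for all $x,y$; the constants $L$ and $L_i$ denote the smallest such numbers. Fractions with zero denominator in upper bounds on the stepsize are read as $+\infty$. Compressors. For $\alpha\in(0,1]$, $\mathbb{B}(\alpha)$ is the set of (possibly) stochastic mappings $\mathcal{C}:\mathbb{R}^d\to\mathbb{R}^d$ with $\mathrm{E}[\|\mathcal{C}(x)-x\|^2]\le(1-\alpha)\|x\|^2$ for all $x\in\mathbb{R}^d$. For $\omega\ge0$, $\mathbb{U}(\omega)$ is the set of stochastic mappings $\mathcal{C}:\mathbb{R}^d\to\mathbb{R}^d$ with $\mathrm{E}[\mathcal{C}(x)]=x$ and $\mathrm{E}[\|\mathcal{C}(x)-x\|^2]\le\omega\|x\|^2$ for all $x\in\mathbb{R}^d$. Algorithm EF21-P + DIANA. Parameters: $\gamma>0$, $\beta$, $x^0\in\mathbb{R}^d$, $w^0=x^0$, shifts $h_1^0,\dots,h_n^0\in\mathbb{R}^d$, $h^0=\frac1n\sum_i h_i^0$. For $t=0,1,\dots,T-1$: $m_i^t=\mathcal{C}_i^D(\nabla f_i(w^t)-h_i^t)$ and $h_i^{t+1}=h_i^t+\beta m_i^t$ for $i=1,\dots,n$; $m^t=\frac1n\sum_i m_i^t$; $g^t=h^t+m^t$; $h^{t+1}=h^t+\beta m^t$; $x^{t+1}=x^t-\gamma g^t$; $w^{t+1}=w^t+\mathcal{C}^P(x^{t+1}-w^t)$. The random draws of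 $\mathcal{C}_1^D,\dots,\mathcal{C}_n^D,\mathcal{C}^P$ are mutually independent and fresh (independent of the past) at every iteration. *)

(* Defs.v *)
From HB Require Import structures.
From mathcomp Require Import all_boot all_order all_algebra.
From mathcomp Require Import all_classical all_reals all_analysis.

Set Implicit Arguments.
Unset Strict Implicit.
Unset Printing Implicit Defensive.

Import Order.TTheory GRing.Theory Num.Theory.
Import numFieldNormedType.Exports.

Local Open Scope classical_set_scope.
Local Open Scope ring_scope.

(* The library's norm `|x| on 'rV[R]_d is the sup norm.  It induces the same
   topology and the same differentiable functions as the Euclidean norm. *)
Definition enorm (R : realType) (d : nat) (x : 'rV[R]_d) : R :=
  Num.sqrt (\sum_(j < d) x 0 j ^+ 2).

Definition gradient (R : realType) (d : nat) (f : 'rV[R]_d -> R)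
    (x : 'rV[R]_d) : 'rV[R]_d :=
  \row_(j < d) 'D_(delta_mx 0 j) f x.

Definition smooth_with (R : realType) (d : nat) (L : R)
    (f : 'rV[R]_d -> R) : Prop :=
  (forall x, differentiable f x) /\
  (forall x y, enorm (gradient f x - gradient f y) <= L * enorm (x - y)).

(* L is the smallest constant for which f is L-smooth.  The restriction to
   nonnegative constants matters only for d = 0, where every real number
   satisfies the inequality. *)
Definition smoothness_constant (R : realType) (d : nat) (L : R)
    (f : 'rV[R]_d -> R) : Prop :=
  [/\ 0 <= L, smooth_with L f &
      forall L' : R, 0 <= L' -> smooth_with L' f -> L <= L'].

Definition borel_rV (R : realType) (d : nat) :=
  g_sigma_algebraType (@open 'rV[R]_d).

(* A stochastic mapping R^d -> R^d is a deterministic map of its input and of a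
   random seed; one draw of the mapping is one draw of the seed.  Joint
   measurability makes the output at a random input a random vector. *)
Record stochastic_map (R : realType) (d : nat) := StochasticMap {
  seed_display : measure_display ;
  seed : measurableType seed_display ;
  seed_law : probability seed R ;
  apply_map :> seed -> 'rV[R]_d -> 'rV[R]_d ;
  measurable_apply_map :
    measurable_fun [set: seed * borel_rV R d]
      (fun p : seed * borel_rV R d => apply_map p.1 p.2 : borel_rV R d) }.

Definition contractive_compressor (R : realType) (d : nat) (alpha : R)
    (C : stochastic_map R d) : Prop :=
  forall x : 'rV[R]_d,
    ('E_(seed_law C)[fun s => (enorm (C s x - x) ^+ 2)%R]
       <= ((1 - alpha) * enorm x ^+ 2)%:E)%E.

(* The expectation of a random vector is taken coordinatewise. *)
Definition unbiased_compressor (R : realType) (d : nat) (omega : R)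
    (C : stochastic_map R d) : Prop :=
  forall x : 'rV[R]_d,
    (forall j, ('E_(seed_law C)[fun s => (C s x 0 j)%R] = (x 0 j)%:E)%E) /\
    ('E_(seed_law C)[fun s => (enorm (C s x - x) ^+ 2)%R]
       <= (omega * enorm x ^+ 2)%:E)%E.

Definition mutually_independent (disp : measure_display)
    (Omega : measurableType disp) (R : realType) (P : probability Omega R)
    (I : eqType) (G : I -> set (set Omega)) : Prop :=
  forall (s : seq I) (A : I -> set Omega),
    uniq s -> (forall i, i \in s -> G i (A i)) ->
    (P (\bigcap_(i in [set` s]) A i) = \prod_(i <- s) P (A i))%E.

Definition generated_events (disp disp' : measure_display)
    (Omega : measurableType disp) (S : measurableType disp')
    (X : Omega -> S) : set (set Omega) :=
  preimage_set_system setT X measurable.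

(* The seeds xiD t i and xiP t used at iteration t by the n compressors CD i and
   by CP have the prescribed laws and are mutually independent over all
   iterations and all compressors; index (t, Some i) stands for xiD t i and
   (t, None) for xiP t. *)
Definition independent_draws (disp : measure_display)
    (Omega : measurableType disp) (R : realType) (P : probability Omega R)
    (d n : nat) (CD : 'I_n -> stochastic_map R d) (CP : stochastic_map R d)
    (xiD : nat -> forall i : 'I_n, {mfun Omega >-> seed (CD i)})
    (xiP : nat -> {mfun Omega >-> seed CP}) : Prop :=
  [/\ forall t i (A : set (seed (CD i))), measurable A ->
        distribution P (xiD t i) A = seed_law (CD i) A,
      forall t (A : set (seed CP)), measurable A ->
        distribution P (xiP t) A = seed_law CP A &
      mutually_independent P
        (fun k : nat * option 'I_n =>
           if k.2 is Some i then generated_events (xiD k.1 i)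
           else generated_events (xiP k.1))].

Record diana_state (R : realType) (d n : nat) := DianaState {
  st_x : 'rV[R]_d ;
  st_w : 'rV[R]_d ;
  st_hi : 'I_n -> 'rV[R]_d ;
  st_h : 'rV[R]_d }.

Definition average (R : realType) (d n : nat) (v : 'I_n -> 'rV[R]_d) :
    'rV[R]_d :=
  n%:R^-1 *: \sum_(i < n) v i.

Definition diana_init (R : realType) (d n : nat) (x0 : 'rV[R]_d)
    (h0 : 'I_n -> 'rV[R]_d) : diana_state R d n :=
  DianaState x0 x0 h0 (average h0).

(* cD i and cP are the realizations of the compressors at this iteration. *)
Definition diana_step (R : realType) (d n : nat) (gamma beta : R)
    (fi : 'I_n -> 'rV[R]_d -> R) (cD : 'I_n -> 'rV[R]_d -> 'rV[R]_d)
    (cP : 'rV[R]_d -> 'rV[R]_d) (s : diana_state R d n) : diana_state R d n :=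
  let mi i := cD i (gradient (fi i) (st_w s) - st_hi s i) in
  let m := average mi in
  let g := st_h s + m in
  let x' := st_x s - gamma *: g in
  {| st_x := x' ;
     st_w := st_w s + cP (x' - st_w s) ;
     st_hi := fun i => st_hi s i + beta *: mi i ;
     st_h := st_h s + beta *: m |}.

Fixpoint diana (R : realType) (d n : nat) (gamma beta : R)
    (fi : 'I_n -> 'rV[R]_d -> R) (disp : measure_display)
    (Omega : measurableType disp)
    (CD : 'I_n -> stochastic_map R d) (CP : stochastic_map R d)
    (xiD : nat -> forall i : 'I_n, {mfun Omega >-> seed (CD i)})
    (xiP : nat -> {mfun Omega >-> seed CP})
    (x0 : 'rV[R]_d) (h0 : 'I_n -> 'rV[R]_d) (t : nat) (w : Omega) :
    diana_state R d n :=
  if t is t'.+1 then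
    diana_step gamma beta fi (fun i => CD i (xiD t' i w)) (CP (xiP t' w))
      (diana gamma beta fi xiD xiP x0 h0 t' w)
  else diana_init x0 h0.

(* Main.v *)
Require Import Defs.
From HB Require Import structures.
From mathcomp Require Import all_boot all_order all_algebra.
From mathcomp Require Import all_classical all_reals all_analysis.
From mathcomp Require Import measurable_realfun ring lra.

Import Order.TTheory GRing.Theory Num.Theory.
Import numFieldNormedType.Exports.
Local Open Scope classical_set_scope.
Local Open Scope ring_scope.

(* One works with the Lyapunov function
     V_t = |x_t - xstar|^2 / (2 gamma) + kappa sum_i |h_i^t - grad f_i(xstar)|^2
           + lambda |w_t - x_t|^2,
   kappa = 8 gamma omega (omega + 1) / n^2, lambda = 2 L / alpha, and shows
     E[V_{t+1} + f(x_{t+1}) - f(xstar)] <= E[V_t + (f(x_t) - f(xstar)) / 2],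
   which telescopes and gives the rate by Jensen's inequality.  Completing the
   square in f(x_{t+1}) - f(xstar) + |x_{t+1} - xstar|^2 / (2 gamma) absorbs the
   inner product with the stochastic error, so that every random quantity met is a
   squared norm |A + c (C(v) - v)|^2 with A and v determined by the past and the
   draw of C fresh: its mean is at most that of |A|^2 + c^2 omega |v|^2.  Hence
   all integrands are nonnegative and Tonelli's theorem suffices; no
   integrability has to be propagated along the iterations.  *)

Set Implicit Arguments.
Unset Strict Implicit.
Unset Printing Implicit Defensive.

(** * Convex and smooth functions on Euclidean space *)

Section euclidean.
Context {R : realType} {d : nat}.
Implicit Types (a b c : 'rV[R]_d) (k s : R).

(** The obstacle is that f is evaluated at the random point x_{t+1} while gradients are taken at
    w_t, where neither the distance nor the gap is tracked by V_t. Two losses pay for this. The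
    choice lambda = 2 L / alpha makes the compression error of w_t shrink with at least L/2 |w_t -
    x_t|^2 to spare, and the shift term of weight kappa shrinks by 8 gamma omega / n^2 times its
    sum, well above what the variance of the workers costs. Every other cost is a small multiple of
    f(w_t) - f(xstar), which is at most 2 (f(x_t) - f(xstar)) + L |w_t - x_t|^2; the spared L/2 |w_t
    - x_t|^2 and half of the gap at x_t cover it. That is where the factor 1/2 of the recursion
    comes from. Being determined by the past is encoded as measurability for a smaller sigma-algebra
    on the same sample space, so that integrals with the past frozen replace conditional
    expectations. *)

Definition dot a b : R := \sum_(j < d) a 0 j * b 0 j.

Lemma enorm_sqr a : enorm a ^+ 2 = dot a a.
Proof.
rewrite sqr_sqrtr; first by apply: eq_bigr => j _; rewrite expr2.
by apply: sumr_ge0 => j _; exact: sqr_ge0.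
Qed.

Lemma dot_ge0 a : 0 <= dot a a.
Proof. by rewrite -enorm_sqr sqr_ge0. Qed.

Lemma dotC a b : dot a b = dot b a.
Proof. by apply: eq_bigr => j _; rewrite mulrC. Qed.

Lemma dotDl a b c : dot (a + b) c = dot a c + dot b c.
Proof. by rewrite -big_split; apply: eq_bigr => j _; rewrite mxE mulrDl. Qed.

Lemma dotZl k a b : dot (k *: a) b = k * dot a b.
Proof. by rewrite mulr_sumr; apply: eq_bigr => j _; rewrite mxE mulrA. Qed.

Lemma dotNl a b : dot (- a) b = - dot a b.
Proof. by rewrite -scaleN1r dotZl mulN1r. Qed.

Lemma dotDr a b c : dot c (a + b) = dot c a + dot c b.
Proof. by rewrite dotC dotDl !(dotC c). Qed.

Lemma dotZr k a b : dot b (k *: a) = k * dot b a.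
Proof. by rewrite dotC dotZl (dotC b). Qed.

Lemma dotNr a b : dot b (- a) = - dot b a.
Proof. by rewrite dotC dotNl (dotC b). Qed.

Lemma dot0l a : dot 0 a = 0.
Proof. by rewrite -(scale0r 0) dotZl mul0r. Qed.

Lemma dot0r a : dot a 0 = 0.
Proof. by rewrite dotC dot0l. Qed.

Definition dotE := (dotDl, dotDr, dotNl, dotNr, dotZl, dotZr, dot0l, dot0r).

Lemma dot_suml n (u : 'I_n -> 'rV[R]_d) a :
  dot (\sum_(i < n) u i) a = \sum_(i < n) dot (u i) a.
Proof.
by elim/big_ind2 : _ => [|u1 r1 u2 r2 <- <-|//]; rewrite ?dot0l ?dotDl.
Qed.

Lemma dot_eq0 a : dot a a = 0 -> a = 0.
Proof.
move=> /eqP; rewrite psumr_eq0 => [/allP a0|j _]; last exact: sqr_ge0.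
apply/rowP => j; rewrite mxE; apply/eqP.
by have := a0 j (mem_index_enum _); rewrite mulf_eq0 orbb.
Qed.

Lemma young a b s : 0 < s -> 2 * dot a b <= s * dot a a + s^-1 * dot b b.
Proof.
move=> s0; have := dot_ge0 (s *: a - b); rewrite !dotE (dotC b a) => h.
have si : s * s^-1 = 1 by rewrite mulfV// gt_eqF.
have : 0 <= s^-1 * (s * (s * dot a a) - s * dot a b - s * dot a b + dot b b).
  by apply: mulr_ge0; [rewrite invr_ge0 ltW | lra].
have -> : s^-1 * (s * (s * dot a a) - s * dot a b - s * dot a b + dot b b) =
   s * s^-1 * (s * dot a a) - s * s^-1 * (2 * dot a b) + s^-1 * dot b b by ring.
rewrite si; lra.
Qed.

Lemma dotD_young a b s : 0 < s ->
  dot (a + b) (a + b) <= (1 + s) * dot a a + (1 + s^-1) * dot b b.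
Proof. by move=> /(young a b); rewrite !dotE (dotC b a); lra. Qed.

Lemma dotB_le a b : dot (a - b) (a - b) <= 2 * dot a a + 2 * dot b b.
Proof. by have := dotD_young a (- b) ltr01; rewrite invr1 !dotE; lra. Qed.

End euclidean.

(** * Gradients: convexity, smoothness and their consequences at a minimum *)

Section gradient.
Context {R : realType} {d : nat}.
Implicit Types (f : 'rV[R]_d -> R) (x y v : 'rV[R]_d).

Lemma derive_gradient f x v : differentiable f x ->
  'D_v f x = dot (gradient f x) v.
Proof.
move=> df; rewrite deriveE// [v in LHS]row_sum_delta linear_sum/=.
by apply: eq_bigr => j _; rewrite linearZ/= mxE deriveE// mulrC.
Qed.

Lemma is_derive_line f x v (t : R) : differentiable f (x + t *: v) ->
  is_derive t 1 (fun s : R => f (x + s *: v))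
    (dot (gradient f (x + t *: v)) v).
Proof.
move=> df; have : derivable f (x + t *: v) v by exact: diff_derivable.
have E : (fun h : R => h^-1 *: ((f \o shift (x + t *: v)) (h *: v)
      - f (x + t *: v))) =
    (fun h : R => h^-1 *: (((fun s : R => f (x + s *: v)) \o shift t) (h *: 1)
      - f (x + t *: v))).
  apply/funext => h /=; congr (_ *: (f _ - _)).
  by rewrite scalerDl [h%:A]mulr1 addrCA.
rewrite /derivable E => cf; apply: DeriveDef => //.
by rewrite -derive_gradient// /derive E.
Qed.

Definition first_order_convex f :=
  forall x y, f x + dot (gradient f x) (y - x) <= f y.

(** The chord inequality with weight h on y bounds the difference quotient at x in the direction y -
    x by f y - f x; let h tend to 0 from the right. *)
Lemma convex_first_order f : (forall x, differentiable f x) ->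
  convex_function [set: 'rV[R]_d] f -> first_order_convex f.
Proof.
move=> df cf x y; rewrite -lerBrDl -derive_gradient//.
have /cvg_dnbhs_at_right : derivable f x (y - x) by exact: diff_derivable.
move=> /cvgr_to_le; apply.
near=> h.
have h0 : 0 < h by near: h; exact: nbhs_right_gt.
have h1 : h <= 1 by near: h; apply: nbhs_right_ltW.
have := @cf (Itv01 (ltW h0) h1) y x (in_setT _) (in_setT _).
rewrite convRE /conv /= => fh.
rewrite /GRing.scale /= mulrC ler_pdivrMr//.
suff -> : h *: (y - x) + x = h *: y + (1 - h) *: x.
  by move: fh; rewrite /unstable.onem /=; lra.
by rewrite scalerBr scalerBl scale1r -!addrA (addrC (- _)).
Unshelve. all: by end_near. Qed.

(** [phi] is f along the segment minus the linear and quadratic terms of the claim, so the claim is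
    [phi 1 <= phi 0]. Monotonicity replaces the integral of the gradient: the derivative at t is <q
    - p, v> - L t |v|^2, which is nonpositive by the Lipschitz bound and Young's inequality with
    weight 1/(L t). Only interior points of [0, 1] matter, hence t > 0. *)
Lemma descent f (L : R) x y : 0 < L -> smooth_with L f ->
  f y <= f x + dot (gradient f x) (y - x) + L / 2 * dot (y - x) (y - x).
Proof.
move=> L0 [df sf]; set v := y - x; set p := gradient f x.
pose phi (t : R) := f (x + t *: v) - t * dot p v - L / 2 * dot v v * t ^+ 2.
have dphi (t : R) : is_derive t 1 phi
    (dot (gradient f (x + t *: v)) v - dot p v - L * dot v v * t).
  have := is_derive_line (df (x + t *: v)).
  move: (dot (gradient f (x + t *: v)) v) => D fl.
  by apply: is_derive_eq; rewrite /GRing.scale /=; field.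
have : phi 1 <= phi 0.
  apply: (@ler0_derive1_nincr _ phi 0 1) => //.
  - move=> t; rewrite in_itv /= => /andP[t0 t1].
    rewrite derive1E derive_val.
    have Lt : 0 < L * t by rewrite mulr_gt0.
    have := sf (x + t *: v) x; rewrite [x + _ - x]addrAC subrr add0r.
    rewrite -ler_sqr ?nnegrE ?sqrtr_ge0 ?mulr_ge0 ?sqrtr_ge0 ?(ltW L0)//.
    rewrite exprMn !enorm_sqr -/p.
    set q := gradient f _ => qp.
    have /(young (q - p) v) : 0 < (L * t)^-1 by rewrite invr_gt0.
    rewrite invrK.
    have : (L * t)^-1 * dot (q - p) (q - p) <= L * t * dot v v.
      rewrite mulrC ler_pdivrMr//.
      by apply: (le_trans qp); rewrite !dotE; lra.
    by rewrite !dotE; lra.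
  - by apply: derivable_within_continuous => t _.
by rewrite /phi scale1r scale0r addr0 /v (addrC x) subrK -/v; lra.
Qed.

Lemma smooth_le f (L M : R) : smooth_with L f -> L <= M -> smooth_with M f.
Proof.
move=> [df sf] LM; split=> // x y; apply: (le_trans (sf x y)).
by rewrite ler_wpM2r// sqrtr_ge0.
Qed.

(* The gradient step w - M^-1 q keeps the value of the convex function
   z |-> f z - <grad f x, z> above its minimum, which is attained at x. *)
Lemma bregman_lower_bound f (M : R) x w : 0 < M -> smooth_with M f ->
  first_order_convex f ->
  dot (gradient f w - gradient f x) (gradient f w - gradient f x)
    <= 2 * M * (f w - f x - dot (gradient f x) (w - x)).
Proof.
move=> M0 sf cf; set q := gradient f w - _.
have Mi : M * M^-1 = 1 by rewrite mulfV// gt_eqF.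
have Mi0 : 0 < M^-1 by rewrite invr_gt0.
have := descent w (w - M^-1 *: q) M0 sf; have := cf x (w - M^-1 *: q).
rewrite [w - _ - w]addrAC subrr add0r.
have -> : gradient f w = gradient f x + q by rewrite addrC subrK.
move: (gradient f x) => p h1 h2.
have h : M^-1 * dot q q / 2 <= f w - f x - (dot p w - dot p x).
  have E : M / 2 * dot (- (M^-1 *: q)) (- (M^-1 *: q)) = M^-1 * dot q q / 2.
    by rewrite !dotE; field; rewrite gt_eqF.
  move: h1 h2; rewrite E !dotE; lra.
have : M * (M^-1 * dot q q / 2) <= M * (f w - f x - (dot p w - dot p x)).
  by rewrite ler_pM2l.
have -> : M * (M^-1 * dot q q / 2) = M * M^-1 * dot q q / 2 by ring.
rewrite Mi !dotE; lra.
Qed.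

(** A gradient step of length 1/L from w lowers f by at least |grad f w|^2 / (2 L), and it cannot
    pass below the minimum. *)
Lemma gradient_le_gap f (L : R) x w : 0 < L -> smooth_with L f ->
  (forall z, f x <= f z) ->
  dot (gradient f w) (gradient f w) <= 2 * L * (f w - f x).
Proof.
move=> L0 sf fx; set q := gradient f w.
have Li : L * L^-1 = 1 by rewrite mulfV// gt_eqF.
have := descent w (w - L^-1 *: q) L0 sf; have := fx (w - L^-1 *: q).
rewrite [w - _ - w]addrAC subrr add0r -/q => h1 h2.
have h : L^-1 * dot q q / 2 <= f w - f x.
  have E : L / 2 * dot (- (L^-1 *: q)) (- (L^-1 *: q)) = L^-1 * dot q q / 2.
    by rewrite !dotE; field; rewrite gt_eqF.
  move: h1 h2; rewrite E !dotE; lra.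
have : L * (L^-1 * dot q q / 2) <= L * (f w - f x) by rewrite ler_pM2l.
have -> : L * (L^-1 * dot q q / 2) = L * L^-1 * dot q q / 2 by ring.
rewrite Li; lra.
Qed.

Lemma gradient_minimum f (L : R) x : 0 < L -> smooth_with L f ->
  (forall z, f x <= f z) -> gradient f x = 0.
Proof.
move=> L0 sf fx; apply/dot_eq0/eqP; rewrite eq_le dot_ge0 andbT.
by have := gradient_le_gap x L0 sf fx; rewrite subrr mulr0.
Qed.

(** Transfers the gap from w_t, where gradients are taken, to x_t, where the recursion is stated. In
    the descent inequality from x, Young's inequality with weight 1/L leaves |grad f x|^2 / (2 L),
    which is at most the gap at x; this is the origin of the factor 2. *)
Lemma gap_le f (L : R) z x w : 0 < L -> smooth_with L f ->
  (forall y, f z <= f y) ->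
  f w - f z <= 2 * (f x - f z) + L * dot (w - x) (w - x).
Proof.
move=> L0 sf fz.
have := descent x w L0 sf; have := gradient_le_gap x L0 sf fz.
have /(young (gradient f x) (w - x)) : 0 < L^-1 by rewrite invr_gt0.
rewrite invrK => h1 h2 h3.
have : L^-1 * dot (gradient f x) (gradient f x) <= 2 * (f x - f z).
  by rewrite mulrC ler_pdivrMr//; lra.
lra.
Qed.

(** Sum the tangent inequalities at the mean z: the linear terms cancel. *)
Lemma first_order_jensen f (T : nat) (x : nat -> 'rV[R]_d) : (0 < T)%N ->
  first_order_convex f ->
  f (T%:R^-1 *: \sum_(1 <= t < T.+1) x t)
    <= T%:R^-1 * \sum_(1 <= t < T.+1) f (x t).
Proof.
move=> T0 cf; set z := _ *: _.
have TR : T%:R != 0 :> R by rewrite pnatr_eq0 -lt0n.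
have : \sum_(1 <= t < T.+1) (f z + dot (gradient f z) (x t - z))
    <= \sum_(1 <= t < T.+1) f (x t) by apply: ler_sum => t _.
rewrite big_split /= sumr_const_nat subn1 /=.
have -> : \sum_(1 <= t < T.+1) dot (gradient f z) (x t - z) = 0.
  have E : dot (gradient f z) (\sum_(1 <= t < T.+1) (x t - z)) =
      \sum_(1 <= t < T.+1) dot (gradient f z) (x t - z).
    by elim/big_ind2 : _ => [|u1 r1 u2 r2 <- <-|//]; rewrite ?dot0r ?dotDr.
  rewrite -E big_split /= sumr_const_nat subn1 /= -[in - z *+ _]scaler_nat.
  by rewrite scalerN /z scalerA mulfV// scale1r subrr dot0r.
by rewrite addr0 ler_pdivlMl ?ltr0n// mulr_natl.
Qed.

End gradient.

Section average_gradient.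
Context {R : realType} {d n : nat} (n_gt0 : (0 < n)%N).
Variables (f : 'rV[R]_d -> R) (fi : 'I_n -> 'rV[R]_d -> R).
Hypotheses (fE : forall x, f x = n%:R^-1 * \sum_(i < n) fi i x)
  (dfi : forall i x, differentiable (fi i) x).

Lemma gradient_average x : gradient f x = average (fun i => gradient (fi i) x).
Proof.
have -> : f = n%:R^-1 \*: (\sum_(i < n) fi i).
  by apply/funext => z; rewrite fE /= fct_sumE.
apply/rowP => j; rewrite !mxE deriveZ; last first.
  by apply: derivable_sum => i; exact: diff_derivable.
rewrite derive_sum; last by move=> i; exact: diff_derivable.
by rewrite summxE; congr (_ * _); apply: eq_bigr => i _; rewrite mxE.
Qed.

Lemma first_order_convex_average :
  (forall i, first_order_convex (fi i)) -> first_order_convex f.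
Proof.
move=> cfi x y; rewrite gradient_average !fE /average dotZl dot_suml -mulrDr.
rewrite ler_pM2l ?invr_gt0 ?ltr0n// -big_split/=.
by apply: ler_sum => i _; exact: cfi.
Qed.

End average_gradient.

(** * Measurability of random vectors *)

Section borel_vectors.
Context {R : realType} {d : nat} {disp : measure_display}
  {T : measurableType disp}.

Lemma borel_rV_measurableE :
  @measurable _ (borel_rV R d) = <<s @open 'rV[R]_d >>.
Proof. by []. Qed.

Lemma continuous_measurable_rV (f : 'rV[R]_d -> R) : continuous f ->
  measurable_fun [set: borel_rV R d] (f : borel_rV R d -> R).
Proof.
move=> /continuousP cf.
apply: (@measurability _ _ (borel_rV R d) R setT f _ (RGenOpens.measurableE R)).
move=> _ [_ [a [b ->]] <-]; rewrite setTI; apply: sub_sigma_algebra.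
exact/cf/interval_open.
Qed.

Lemma measurable_coord (X : T -> borel_rV R d) (j : 'I_d) :
  measurable_fun setT X -> measurable_fun setT (fun t => X t 0 j : R).
Proof.
move=> mX; have := continuous_measurable_rV (@coord_continuous R 1 d 0 j).
by move=> /measurableT_comp; apply.
Qed.

(* An open set is the union of the countably many cubes with rational centre
   and radius 1/m that it contains. *)
Lemma measurable_rV (X : T -> borel_rV R d) :
  (forall j, measurable_fun setT (fun t => X t 0 j : R)) ->
  measurable_fun setT X.
Proof.
move=> mX; apply: (@measurability _ _ T (borel_rV R d) setT X _
  borel_rV_measurableE).
move=> _ [U oU <-]; rewrite setTI.
pose cube (q : 'rV[rat]_d * nat) : set 'rV[R]_d :=
  [set x | forall j, ball (ratr (q.1 0 j) : R) (q.2.+1%:R^-1) (x 0 j)].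
(* Cubes that leave U contribute the empty set, so the union runs over the whole countable type of
   pairs. *)
pose F q : set T := if `[< cube q `<=` U >] then X @^-1` (cube q) else set0.
have -> : X @^-1` U = \bigcup_q F q.
  apply/seteqP; split=> [t /= Ut|t [q _]]; last first.
    by rewrite /F; case: asboolP => // qU /qU.
  have : nbhs (X t : 'rV[R]_d) U by exact: open_nbhs_nbhs.
  rewrite -nbhs_ballE => -[e /= e0 eU].
  (* Two points of a cube of radius 1/(m+1) are less than 2/(m+1) apart in every coordinate, so a
     cube around [X t] stays in the sup-norm ball of radius [e]. *)
  have [m me] : exists m : nat, 2 * m.+1%:R^-1 < e.
    have e2 : 0 < e / 2 by rewrite divr_gt0.
    have [m _ /(_ m (leqnn m))] := near_infty_natSinv_lt (PosNum e2).
    by move=> /= me; exists m; rewrite mulrC -ltr_pdivlMr.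
  have m0 : 0 < m.+1%:R^-1 :> R by rewrite invr_gt0 ltr0n.
  have rj j : {q : rat | ratr q \in `](X t 0 j - m.+1%:R^-1),
      (X t 0 j + m.+1%:R^-1)[}.
    by apply: cid; apply: rat_in_itvoo; rewrite ltrBlDr -addrA ltrDl addr_gt0.
  exists (\row_j projT1 (rj j), m) => //; rewrite /F.
  have tq : cube (\row_j projT1 (rj j), m) (X t).
    move=> j /=; rewrite mxE; have := projT2 (rj j).
    rewrite /ball /= ltr_distl in_itv /=; move: (ratr _) => r.
    by move: (m.+1%:R^-1) => u /andP[r1 r2]; apply/andP; split; lra.
  case: asboolP => // -[x qx]; apply: eU; split=> // i j.
  rewrite ord1; have := qx j; have := tq j.
  rewrite /ball /= !ltr_distl; move: (ratr _) => r.
  move: (m.+1%:R^-1) me => u me /andP[a1 a2] /andP[a3 a4].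
  by apply/andP; split; lra.
apply: countable_bigcupT_measurable => // q; rewrite /F.
case: asboolP => // _.
have -> : X @^-1` cube q = \bigcap_(j in [set: 'I_d])
    (fun t => X t 0 j : R) @^-1` (ball (ratr (q.1 0 j) : R) (q.2.+1%:R^-1)).
  by apply/seteqP; split=> t /= h j; [move=> _; exact: h|exact: h].
apply: fin_bigcap_measurable => // j _; rewrite -[X in measurable X]setTI.
by apply: mX => //; exact: measurable_ball.
Qed.

Lemma measurable_rVD (X Y : T -> borel_rV R d) :
  measurable_fun setT X -> measurable_fun setT Y ->
  measurable_fun setT (fun t => (X t : 'rV[R]_d) + Y t : borel_rV R d).
Proof.
move=> mX mY; apply: measurable_rV => j; under eq_fun do rewrite mxE.
by apply: measurable_funD; exact: measurable_coord.
Qed.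

Lemma measurable_rVZ (k : R) (X : T -> borel_rV R d) :
  measurable_fun setT X ->
  measurable_fun setT (fun t => k *: (X t : 'rV[R]_d) : borel_rV R d).
Proof.
move=> mX; apply: measurable_rV => j; under eq_fun do rewrite mxE.
by apply: measurable_funM => //; exact: measurable_coord.
Qed.

Lemma measurable_rVB (X Y : T -> borel_rV R d) :
  measurable_fun setT X -> measurable_fun setT Y ->
  measurable_fun setT (fun t => (X t : 'rV[R]_d) - Y t : borel_rV R d).
Proof.
move=> mX mY; under eq_fun do rewrite -scaleN1r.
by apply: measurable_rVD => //; exact: measurable_rVZ.
Qed.

Lemma measurable_rV_sum (I : Type) (s : seq I) (p : pred I)
    (X : I -> T -> borel_rV R d) :
  (forall i, measurable_fun setT (X i)) ->
  measurable_fun setT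
    (fun t => \sum_(i <- s | p i) (X i t : 'rV[R]_d) : borel_rV R d).
Proof.
move=> mX; under eq_fun do rewrite big_mkcond.
elim: s => [|i s ih].
  under eq_fun do rewrite big_nil.
  exact: (@measurable_cst _ _ T (borel_rV R d)).
under eq_fun do rewrite big_cons.
apply: measurable_rVD => //; case: (p i); first exact: mX.
exact: (@measurable_cst _ _ T (borel_rV R d)).
Qed.

Lemma measurable_dot (X Y : T -> borel_rV R d) :
  measurable_fun setT X -> measurable_fun setT Y ->
  measurable_fun setT (fun t => dot (X t) (Y t)).
Proof.
move=> mX mY; apply: measurable_sum => j.
by apply: measurable_funM; exact: measurable_coord.
Qed.

End borel_vectors.

Section smooth_measurable.
Context {R : realType} {d : nat}.
Implicit Types f : 'rV[R]_d -> R.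

Lemma measurable_smooth f (L : R) : smooth_with L f ->
  measurable_fun [set: borel_rV R d] (f : borel_rV R d -> R).
Proof.
move=> [df _]; apply: continuous_measurable_rV => x.
exact: differentiable_continuous.
Qed.

(** Each partial derivative is the pointwise limit of the difference quotients with step 1/(m+1),
    which are measurable because f is continuous. *)
Lemma measurable_gradient f (L : R) : smooth_with L f ->
  measurable_fun [set: borel_rV R d]
    (gradient f : borel_rV R d -> borel_rV R d).
Proof.
move=> sf; apply: measurable_rV => j.
pose h (m : nat) (x : 'rV[R]_d) : R :=
  m.+1%:R * (f (m.+1%:R^-1 *: delta_mx 0 j + x) - f x).
apply: (@measurable_fun_cvg _ (borel_rV R d) R setT h) => [m|x _].
  have mf := measurable_smooth sf.
  apply: measurable_funM => //; apply: measurable_funB => //.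
  apply: (measurableT_comp mf); apply: measurable_rVD.
    exact: (@measurable_cst _ _ (borel_rV R d) (borel_rV R d)).
  exact: measurable_id.
have hE : h ^~ x = (fun m => m.+1%:R^-1^-1 *
    (f (m.+1%:R^-1 *: delta_mx 0 j + x) - f x)).
  by apply/funext => m; rewrite invrK.
rewrite mxE hE; have /cvg_dnbhs_at_right : derivable f x (delta_mx 0 j).
  by apply: diff_derivable; case: sf.
move=> /cvg_at_rightP/(_ (fun m => m.+1%:R^-1)); apply.
split=> [m|]; first by rewrite invr_gt0.
exact: cvg_harmonic.
Qed.

End smooth_measurable.

(** * Independence of the past *)

Section independence.
Context {disp : measure_display} {Omega : measurableType disp} {R : realType}
  (P : probability Omega R) {I : eqType} (G : I -> set (set Omega)).
Hypotheses (G_measurable : forall i, G i `<=` measurable)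
  (GI : forall i, setI_closed (G i)) (GT : forall i, G i setT)
  (indep : mutually_independent P G).

(** The sample space itself with the sigma-algebra generated by the indices in K. Keeping the
    carrier lets one function be read both as a random variable on [Omega] and as a function of the
    seeds in K. *)
Definition past (K : set I) :=
  g_sigma_algebraType (\bigcup_(k in K) G k).

Lemma past_measurable (K : set I) (A : set Omega) :
  (<<s \bigcup_(k in K) G k >>) A -> measurable A.
Proof.
apply: smallest_sub; first exact: sigma_algebra_measurable.
by move=> B [k _]; exact: G_measurable.
Qed.

Lemma measurable_past_id (K : set I) :
  measurable_fun [set: Omega] (id : Omega -> past K).
Proof. by move=> _ A mA; rewrite setTI; exact: (@past_measurable K). Qed.

Lemma measurable_past_sub (K K' : set I) : K `<=` K' ->
  measurable_fun [set: past K'] (id : past K' -> past K).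
Proof.
move=> KK' _ A; rewrite setTI; apply: sub_sigma_algebra2.
exact: bigcup_subset.
Qed.

(** Uniqueness of finite measures on a pi-system: [P (_]&[B)] and [P B] times P agree on the finite
    intersections [E] of events indexed by K, and [E] generates the past. *)
Lemma past_independent (K : set I) (k : I) (A B : set Omega) : ~ K k ->
  (<<s \bigcup_(k in K) G k >>) A -> G k B -> P (A `&` B) = (P A * P B)%E.
Proof.
move=> nKk mA GB; have mB := G_measurable GB.
pose E : set (set Omega) :=
  [set C | exists s : seq I, exists F : I -> set Omega,
  [/\ uniq s, forall i, i \in s -> K i, forall i, i \in s -> G i (F i) &
      C = \bigcap_(i in [set` s]) F i]].
have Em : E `<=` measurable.
  move=> _ [s [F [us Ks GF ->]]]; apply: fin_bigcap_measurable => // i /GF.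
  exact: G_measurable.
have EI : setI_closed E.
  move=> _ _ [s [F [us Ks GF ->]]] [s' [F' [us' Ks' GF' ->]]].
  (* Padding by the whole space outside the index list lets two finite families be intersected index
     by index over the union of their lists. *)
  pose H (s : seq I) (F : I -> set Omega) i := if i \in s then F i else setT.
  exists (undup (s ++ s')), (fun i => H s F i `&` H s' F' i).
  split=> [|i|i|]; first exact: undup_uniq.
  - by rewrite mem_undup mem_cat => /orP[/Ks|/Ks'].
  - by rewrite /H => _; case: ifPn => is_; case: ifPn => is'; apply: GI;
      rewrite ?GT//; [exact: GF|exact: GF'|exact: GF|exact: GF'].
  - apply/seteqP; split=> w.
      move=> [h h'] i _; rewrite /H; split; case: ifPn => // ii.
        exact: h.
      exact: h'.
    move=> h; split=> i /= ii.
      by have [] := h i; rewrite /= ?mem_undup ?mem_cat ?ii// /H ii.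
    by have [] := h i; rewrite /= ?mem_undup ?mem_cat ?ii ?orbT// /H ii.
have ET : E setT.
  by exists [::], (fun=> setT); split=> //; apply/seteqP; split.
have PB0 : 0 <= fine (P B) by rewrite fine_ge0.
have PBE : P B = (fine (P B))%:E by rewrite fineK// fin_num_measure.
have EE : (<<s E >>) A.
  apply: sub_sigma_algebra2 mA => C [i Ki GC]; exists [:: i], (fun=> C).
  split=> // [j|j|]; rewrite ?inE.
  - by move=> /eqP ->.
  - by move=> /eqP ->.
  - by rewrite set_cons1 bigcap_set1.
rewrite muleC [in RHS]PBE.
apply: (g_sigma_algebra_measure_unique E Em (fun _ : nat => setT)
  (fun _ : nat => ET) _ (mrestr P mB) (mscale (NngNum PB0) P)) => //.
- by rewrite bigcup_const.
- move=> _ [s [F [us Ks GF ->]]].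
  set C := \bigcap_(i in _) _.
  suff : P (C `&` B) = ((fine (P B))%:E * P C)%E by [].
  rewrite -PBE /C {C}.
  (* The family is extended by B at the index k, which is not in [s] since the indices of [s] lie in
     K; mutual independence then applies to [k :: s]. *)
  pose F' i := if i == k then B else F i.
  have ks : k \notin s by apply/negP => /Ks.
  have := indep (s := k :: s) (A := F').
  rewrite cons_uniq ks us big_cons => /(_ isT).
  have -> : \bigcap_(i in [set` k :: s]) F' i =
      (\bigcap_(i in [set` s]) F i) `&` B.
    apply/seteqP; split=> w /= => [h|[h wB] i].
      split=> [i /= is_|]; last first.
        by have := h k; rewrite /F' /= eqxx inE eqxx; apply.
      have := h i; rewrite /F' /= inE is_ orbT.
      by case: eqP => [ik|_]; [rewrite -ik is_ in ks|apply].
    by rewrite /F' /= inE; case: eqP => // _ /= /h.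
  move=> -> => [|i]; last first.
    rewrite inE /F'; case: eqP => [-> //|_ /=]; exact: GF.
  rewrite /F' eqxx; congr (_ * _)%E.
  rewrite (indep us GF); apply: eq_big_seq => i is_.
  by case: eqP => // ik; rewrite -ik is_ in ks.
- move=> _; suff : (P (setT `&` B) < +oo)%E by [].
  by rewrite -ge0_fin_numE// fin_num_measure// setTI.
Qed.

Context {dS : measure_display} {S : measurableType dS} (mu : probability S R)
  (X : {mfun Omega >-> S}) (K : set I) (k : I).
Hypotheses (X_law : forall A, measurable A -> distribution P X A = mu A)
  (X_gen : generated_events X = G k) (nKk : ~ K k).

(* A seed that is independent of the past may be integrated out first, the past
   being frozen. *)
Lemma integral_fresh (phi : past K * S -> \bar R) :
  measurable_fun setT phi -> (forall z, (0 <= phi z)%E) ->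
  (\int[P]_w phi (w, X w) = \int[P]_w \int[mu]_s phi (w, s))%E.
Proof.
move=> mphi phi0.
pose idK : {mfun Omega >-> past K} :=
  HB.pack (id : Omega -> past K) (isMeasurableFun.Build _ _ _ _
    (id : Omega -> past K) (@measurable_past_id K)).
have mXK : measurable_fun [set: Omega] (fun w => (idK w, X w)).
  by apply: measurable_fun_pair.
pose XK : {mfun Omega >-> (past K * S)%type} :=
  HB.pack (fun w => (idK w, X w)) (isMeasurableFun.Build _ _ _ _
    (fun w => (idK w, X w)) mXK).
transitivity (\int[distribution P XK]_z phi z)%E.
  by rewrite ge0_integral_distribution.
(* Independence makes the joint law of past and seed a product measure; it is enough to compare them
   on rectangles. *)
transitivity (\int[(distribution P idK \x mu)%E]_z phi z)%E.
  apply: eq_measure_integral => A mA _.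
  apply/esym; apply: product_measure_unique => // B C mB mC.
  suff : P (B `&` X @^-1` C) = (P B * mu C)%E by [].
  rewrite -X_law// (past_independent nKk mB)//.
  by rewrite -X_gen; exists C => //; rewrite setTI.
rewrite fubini_tonelli1// ge0_integral_distribution//.
  exact: measurable_fun_fubini_tonelli_F.
by move=> w; exact: integral_ge0.
Qed.

End independence.

(** * Comparison of means *)

Section means.
Context {disp : measure_display} {T : measurableType disp} {R : realType}
  (P : probability T R).
Implicit Types (X Y Z : T -> R) (k m : R).

(** Integrability is included because this notion serves signed variables, namely the coordinates of
    a compression error at a fixed input. *)
Definition has_mean X m :=
  P.-integrable setT (EFin \o X) /\ (\int[P]_w (X w)%:E = m%:E)%E.

Lemma has_mean_cst k : has_mean (fun=> k) k.
Proof.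
split; first exact: finite_measure_integrable_cst.
by have := expectation_cst P k; rewrite unlock.
Qed.

Lemma has_meanD X Y m k : has_mean X m -> has_mean Y k ->
  has_mean (fun w => X w + Y w) (m + k).
Proof.
move=> [iX mX] [iY mY]; split.
  by have := integrableD measurableT iX iY.
under eq_integral do rewrite EFinD.
by rewrite integralD// mX mY.
Qed.

Lemma has_meanZ X m k : has_mean X m -> has_mean (fun w => k * X w) (k * m).
Proof.
move=> [iX mX]; split; first by have := integrableZl measurableT k iX.
under eq_integral do rewrite EFinM.
by rewrite integralZl// mX.
Qed.

Lemma has_mean_sum n (X : 'I_n -> T -> R) (m : 'I_n -> R) :
  (forall i, has_mean (X i) (m i)) ->
  has_mean (fun w => \sum_(i < n) X i w) (\sum_(i < n) m i).
Proof.
move=> h; elim: (index_enum _) => [|i s ih].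
  under eq_fun do rewrite big_nil; rewrite big_nil; exact: has_mean_cst.
under eq_fun do rewrite big_cons; rewrite big_cons; exact: has_meanD.
Qed.

Definition nonneg_rv X := measurable_fun setT X /\ forall w, 0 <= X w.

(** Measurability and nonnegativity travel with the inequality, so it is stable under sums and
    nonnegative multiples even when the integrals are infinite. *)
Definition mean_le X Y :=
  [/\ nonneg_rv X, nonneg_rv Y & (\int[P]_w (X w)%:E <= \int[P]_w (Y w)%:E)%E].

Lemma nonneg_rvD X Y : nonneg_rv X -> nonneg_rv Y ->
  nonneg_rv (fun w => X w + Y w).
Proof.
move=> [mX X0] [mY Y0]; split=> [|w]; first exact: measurable_funD.
exact: addr_ge0.
Qed.

Lemma nonneg_rvZ X k : 0 <= k -> nonneg_rv X -> nonneg_rv (fun w => k * X w).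
Proof.
move=> k0 [mX X0]; split=> [|w]; last exact: mulr_ge0.
exact: measurable_funM.
Qed.

Lemma nonneg_rv_sum (I : Type) (s : seq I) (p : pred I) (X : I -> T -> R) :
  (forall i, nonneg_rv (X i)) -> nonneg_rv (fun w => \sum_(i <- s | p i) X i w).
Proof.
move=> h; split=> [|w]; last by apply: sumr_ge0 => i _; case: (h i).
under eq_fun do rewrite big_mkcond; apply: measurable_sum => i.
by case: (p i); [case: (h i)|exact: measurable_cst].
Qed.

Lemma mean_le_pointwise X Y : nonneg_rv X -> nonneg_rv Y ->
  (forall w, X w <= Y w) -> mean_le X Y.
Proof.
move=> hX hY XY; case: (hX) => mX X0; case: (hY) => mY Y0; split=> //.
apply: ge0_le_integral => //.
- by move=> w _; rewrite lee_fin.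
- exact/measurable_EFinP.
- exact/measurable_EFinP.
- by move=> w _; rewrite lee_fin.
Qed.

Lemma mean_le_refl X : nonneg_rv X -> mean_le X X.
Proof. by []. Qed.

Lemma mean_le_trans Y X Z : mean_le X Y -> mean_le Y Z -> mean_le X Z.
Proof. by move=> [hX _ XY] [_ hZ YZ]; split=> //; exact: le_trans YZ. Qed.

Lemma integralD_nonneg X Y : nonneg_rv X -> nonneg_rv Y ->
  (\int[P]_w (X w + Y w)%:E = \int[P]_w (X w)%:E + \int[P]_w (Y w)%:E)%E.
Proof.
move=> [mX X0] [mY Y0]; under eq_integral do rewrite EFinD.
apply: ge0_integralD => //.
- by move=> w _; rewrite lee_fin.
- exact/measurable_EFinP.
- by move=> w _; rewrite lee_fin.
- exact/measurable_EFinP.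
Qed.

Lemma integralZ_nonneg X k : 0 <= k -> nonneg_rv X ->
  (\int[P]_w (k * X w)%:E = k%:E * \int[P]_w (X w)%:E)%E.
Proof.
move=> k0 [mX X0]; under eq_integral do rewrite EFinM.
apply: ge0_integralZl_EFin => //.
- by move=> w _; rewrite lee_fin.
- exact/measurable_EFinP.
Qed.

Lemma mean_leD X X' Y Y' : mean_le X X' -> mean_le Y Y' ->
  mean_le (fun w => X w + Y w) (fun w => X' w + Y' w).
Proof.
move=> [hX hX' XX'] [hY hY' YY']; split; try exact: nonneg_rvD.
by rewrite !integralD_nonneg// leeD.
Qed.

Lemma mean_leZ X Y k : 0 <= k -> mean_le X Y ->
  mean_le (fun w => k * X w) (fun w => k * Y w).
Proof.
move=> k0 [hX hY XY]; split; try exact: nonneg_rvZ.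
by rewrite !integralZ_nonneg// lee_wpmul2l// lee_fin.
Qed.

Lemma mean_le_sum n (X Y : 'I_n -> T -> R) :
  (forall i, mean_le (X i) (Y i)) ->
  mean_le (fun w => \sum_(i < n) X i w) (fun w => \sum_(i < n) Y i w).
Proof.
move=> h; elim: (index_enum _) => [|i s ih].
  under eq_fun do rewrite big_nil.
  under [X in mean_le _ X]eq_fun do rewrite big_nil.
  by apply: mean_le_refl; split=> // w.
under eq_fun do rewrite big_cons.
under [X in mean_le _ X]eq_fun do rewrite big_cons.
exact: mean_leD.
Qed.

End means.

(** A finite bound on the mean of a nonnegative variable gives back integrability, needed before the
    constant f(xstar) can be separated from the expectation. *)
Lemma mean_le_cst (R : realType) (disp : measure_display)
    (T : measurableType disp) (P : probability T R) (X : T -> R) (k : R) :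
  mean_le P X (fun=> k) -> exists2 m, has_mean P X m & m <= k.
Proof.
move=> [[mX X0] _]; have [_ ->] := has_mean_cst P k => Xk.
have iX : P.-integrable setT (EFin \o X).
  apply/integrableP; split; first exact/measurable_EFinP.
  under eq_integral do rewrite /= ger0_norm//.
  by apply: (le_lt_trans Xk); rewrite ltry.
have fX : (\int[P]_w (X w)%:E)%E \is a fin_num by exact: integrable_fin_num.
exists (fine (\int[P]_w (X w)%:E)); last by rewrite -lee_fin fineK.
by split=> //; rewrite fineK.
Qed.

(** In product form the convention on zero denominators is harmless: for b = 0 the conclusion is
    just 0 <= a. *)
Lemma le_mul_of_ereal_div (R : realType) (g a b : R) : 0 <= a -> 0 <= b ->
  (g%:E <= a%:E / b%:E)%E -> b * g <= a.
Proof.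
move=> a0; rewrite le_eqVlt => /orP[/eqP<- _|b0]; first by rewrite mul0r.
by rewrite inver gt_eqF// -EFinM lee_fin ler_pdivlMr// mulrC.
Qed.

(** * Moments of a compressed vector, at a fixed and at a random input *)

Section compressors.
Context {R : realType} {d : nat} (C : stochastic_map R d).

Lemma measurable_apply (dT : measure_display) (T : measurableType dT)
    (X : T -> seed C) (v : T -> borel_rV R d) :
  measurable_fun setT X -> measurable_fun setT v ->
  measurable_fun setT (fun t => C (X t) (v t) : borel_rV R d).
Proof.
move=> mX mv; have mXv := measurable_fun_pair mX mv.
have -> : (fun t => C (X t) (v t) : borel_rV R d) =
    (fun p : seed C * borel_rV R d => C p.1 p.2 : borel_rV R d) \o
    (fun t => (X t, v t)) by [].
exact: measurableT_comp (@measurable_apply_map R d C) mXv.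
Qed.

(** Expanding the square around a, the cross term is linear in the error and has mean zero. The work
    lies in the integrability that makes this linearity legitimate. *)
Lemma unbiased_second_moment (omega c : R) (a v : 'rV[R]_d) :
  unbiased_compressor omega C ->
  (\int[seed_law C]_s
     (dot (a + c *: (C s v - v)) (a + c *: (C s v - v)))%:E
   <= (dot a a + c ^+ 2 * omega * dot v v)%:E)%E.
Proof.
move=> /(_ v) [meanC varC].
pose u s : 'rV[R]_d := C s v - v.
have mu : measurable_fun setT (u : seed C -> borel_rV R d).
  have mv : measurable_fun [set: seed C] (fun=> v : borel_rV R d).
    exact: measurable_cst.
  apply: measurable_rVB => //.
  exact: (measurable_apply (measurable_id (D := setT)) mv).
have muu : measurable_fun setT (fun s => dot (u s) (u s)).
  exact: measurable_dot.
move: varC; rewrite unlock enorm_sqr.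
under eq_integral do rewrite enorm_sqr -/(u _).
move=> varC.
have iuu : (seed_law C).-integrable setT (fun s => (dot (u s) (u s))%:E).
  apply/integrableP; split; first exact/measurable_EFinP.
  under eq_integral do rewrite gee0_abs ?lee_fin ?dot_ge0//.
  by apply: (le_lt_trans varC); rewrite ltry.
have [q [muuq qle]] : exists q, has_mean (seed_law C)
    (fun s => dot (u s) (u s)) q /\ q <= omega * dot v v.
  have fin : (\int[seed_law C]_s (dot (u s) (u s))%:E)%E \is a fin_num.
    exact: integrable_fin_num.
  exists (fine (\int[seed_law C]_s (dot (u s) (u s))%:E)); split.
    by split=> //; rewrite fineK.
  by rewrite -lee_fin fineK.
have mean_u j : has_mean (seed_law C) (fun s => u s 0 j) 0.
  have muj : measurable_fun setT (fun s : seed C => u s 0 j : R).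
    exact: measurable_coord.
  have iuj : (seed_law C).-integrable setT (fun s => (u s 0 j)%:E).
    (* Each coordinate of the error is dominated by 1 + |u|^2, because (|u_j| - 1)^2 >= 0. *)
    have [i1 _] := has_meanD (has_mean_cst (seed_law C) 1) muuq.
    apply: le_integrable i1 => //; first exact/measurable_EFinP.
    move=> s _ /=; rewrite lee_fin [in leRHS]ger0_norm; last first.
      by rewrite addr_ge0 ?dot_ge0.
    have : u s 0 j ^+ 2 <= dot (u s) (u s).
      rewrite /dot (bigD1 j)//= -expr2 lerDl.
      by apply: sumr_ge0 => i _; exact: sqr_ge0.
    have := sqr_ge0 (`|u s 0 j| - 1); rewrite sqrrB1 real_normK ?num_real//.
    have := sqr_ge0 (u s 0 j); lra.
  split=> //; have := meanC j; rewrite unlock => mC.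
  have [iv mv] := has_mean_cst (seed_law C) (v 0 j).
  have iC : (seed_law C).-integrable setT (fun s => (C s v 0 j)%:E).
    have := integrableD measurableT iuj iv.
    by apply: eq_integrable => // s _ /=; rewrite /u !mxE -EFinD subrK.
  under eq_integral do rewrite /u !mxE EFinB.
  by rewrite integralB// mC mv subee.
have E s : dot (a + c *: u s) (a + c *: u s) =
    dot a a + (2 * c * (\sum_(j < d) a 0 j * u s 0 j) +
    c ^+ 2 * dot (u s) (u s)).
  rewrite -/(dot a (u s)); move: (u s) => us.
  by rewrite !dotE (dotC us a); ring.
have [_] := has_meanD (has_mean_cst (seed_law C) (dot a a))
  (has_meanD
    (has_meanZ (2 * c) (has_mean_sum (fun j => has_meanZ (a 0 j) (mean_u j))))
    (has_meanZ (c ^+ 2) muuq)).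
rewrite -/(u _).
under [X in _ -> (X <= _)%E]eq_integral do rewrite -/(u _) E.
move=> ->; rewrite lee_fin lerD2l big1 => [|i _]; last by rewrite mulr0.
by rewrite mulr0 add0r -mulrA ler_wpM2l// sqr_ge0.
Qed.

End compressors.

Section fresh_compressor.
Context {disp : measure_display} {Omega : measurableType disp} {R : realType}
  (P : probability Omega R) {I : eqType} (G : I -> set (set Omega)).
Hypotheses (G_measurable : forall i, G i `<=` measurable)
  (GI : forall i, setI_closed (G i)) (GT : forall i, G i setT)
  (indep : mutually_independent P G).
Context {d : nat} (C : stochastic_map R d) (X : {mfun Omega >-> seed C})
  (K : set I) (k : I).
Hypotheses
  (X_law : forall A, measurable A -> distribution P X A = seed_law C A)
  (X_gen : generated_events X = G k).

Lemma measurable_draw : K k ->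
  measurable_fun [set: past G K] (X : past G K -> seed C).
Proof.
move=> Kk _ A mA; rewrite setTI; apply: sub_sigma_algebra; exists k => //.
by rewrite -X_gen; exists A => //; rewrite setTI.
Qed.

Lemma measurable_compress (v : Omega -> 'rV[R]_d) : K k ->
  measurable_fun [set: past G K] (v : past G K -> borel_rV R d) ->
  measurable_fun [set: past G K]
    (fun w => C (X w) (v w) : borel_rV R d).
Proof.
by move=> Kk mv; apply: measurable_apply => //; exact: measurable_draw.
Qed.

Lemma measurable_past (d' : measure_display) (S : measurableType d')
  (Y : Omega -> S) :
  measurable_fun [set: past G K] (Y : past G K -> S) ->
  measurable_fun [set: Omega] Y.
Proof.
by move=> /measurableT_comp; apply; exact: measurable_past_id.
Qed.

Hypothesis nKk : ~ K k.

Lemma mean_le_fresh (phi : past G K * seed C -> R) (psi : Omega -> R) :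
  measurable_fun setT phi -> (forall z, 0 <= phi z) ->
  measurable_fun [set: past G K] (psi : past G K -> R) ->
  (forall w, 0 <= psi w) ->
  (forall w, (\int[seed_law C]_s (phi (w, s))%:E <= (psi w)%:E)%E) ->
  mean_le P (fun w => phi (w, X w)) psi.
Proof.
move=> mphi phi0 mpsi psi0 phipsi.
have mphiE : measurable_fun setT (EFin \o phi) by exact/measurable_EFinP.
split.
- split=> //.
  have mX : measurable_fun [set: Omega] (X : Omega -> seed C) by [].
  have mwX :=
    measurable_fun_pair (@measurable_past_id _ _ _ G G_measurable K) mX.
  exact: measurableT_comp mphi mwX.
- by split=> //; exact: measurable_past.
rewrite (integral_fresh G_measurable GI GT indep X_law X_gen nKk
  (phi := EFin \o phi))//.
apply: ge0_le_integral => //.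
- by move=> w _; apply: integral_ge0 => s _; rewrite lee_fin.
- apply: measurable_past; exact: measurable_fun_fubini_tonelli_F.
- exact/measurable_EFinP/measurable_past.
- by move=> w _; exact: phipsi.
Qed.

Lemma measurable_joint_error (v : Omega -> 'rV[R]_d) :
  measurable_fun [set: past G K] (v : past G K -> borel_rV R d) ->
  measurable_fun [set: past G K * seed C]
    (fun z => (C z.2 (v z.1) : 'rV[R]_d) - v z.1 : borel_rV R d).
Proof.
move=> mv.
have mv1 : measurable_fun [set: past G K * seed C]
    (fun z => v z.1 : borel_rV R d).
  exact: (measurableT_comp mv measurable_fst).
apply: measurable_rVB => //.
by apply: measurable_apply.
Qed.

Lemma mean_le_unbiased (omega c : R) (a v : Omega -> 'rV[R]_d) :
  0 <= omega -> unbiased_compressor omega C ->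
  measurable_fun [set: past G K] (a : past G K -> borel_rV R d) ->
  measurable_fun [set: past G K] (v : past G K -> borel_rV R d) ->
  mean_le P
    (fun w => dot (a w + c *: (C (X w) (v w) - v w))
                  (a w + c *: (C (X w) (v w) - v w)))
    (fun w => dot (a w) (a w) + c ^+ 2 * omega * dot (v w) (v w)).
Proof.
move=> omega0 unb ma mv.
apply: (mean_le_fresh (phi := fun z => dot
    (a z.1 + c *: (C z.2 (v z.1) - v z.1))
    (a z.1 + c *: (C z.2 (v z.1) - v z.1)))).
- have m : measurable_fun [set: past G K * seed C] (fun z =>
      (a z.1 : 'rV[R]_d) + c *: (C z.2 (v z.1) - v z.1) : borel_rV R d).
    apply: measurable_rVD; first exact: (measurableT_comp ma measurable_fst).
    by apply: measurable_rVZ; exact: measurable_joint_error.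
  exact: measurable_dot.
- by move=> z; exact: dot_ge0.
- apply: measurable_funD; first exact: measurable_dot.
  by apply: measurable_funM => //; exact: measurable_dot.
- move=> w; apply: addr_ge0; first exact: dot_ge0.
  by apply: mulr_ge0; [apply: mulr_ge0 => //; exact: sqr_ge0|exact: dot_ge0].
- by move=> w; have := unbiased_second_moment c (a w) (v w) unb.
Qed.

Lemma mean_le_contractive (alpha : R) (v : Omega -> 'rV[R]_d) :
  alpha <= 1 -> contractive_compressor alpha C ->
  measurable_fun [set: past G K] (v : past G K -> borel_rV R d) ->
  mean_le P
    (fun w => dot (C (X w) (v w) - v w) (C (X w) (v w) - v w))
    (fun w => (1 - alpha) * dot (v w) (v w)).
Proof.
move=> alpha1 contr mv.
apply: (mean_le_fresh (phi := fun z => dot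
    (C z.2 (v z.1) - v z.1) (C z.2 (v z.1) - v z.1))).
- by have m := measurable_joint_error mv; exact: measurable_dot.
- by move=> z; exact: dot_ge0.
- by apply: measurable_funM => //; exact: measurable_dot.
- by move=> w; rewrite mulr_ge0 ?dot_ge0// subr_ge0.
- move=> w; have := contr (v w); rewrite unlock enorm_sqr.
  by under eq_integral do rewrite enorm_sqr.
Qed.

End fresh_compressor.

(** * The Lyapunov function along one step *)

(** The scalar budget of one step. F and Gp stand for the gaps at x and at w, W for |w - x|^2, X1
    for |x - gamma grad f(w) - w|^2, N for |grad f(w)|^2, Rr for |x - xstar|^2, and S, HS, BS for
    the sums of squares of grad f_i(w) - h_i, h_i - grad f_i(xstar) and grad f_i(w) - grad
    f_i(xstar). *)
Lemma lyapunov_coefficients (R : realFieldType)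
    (alpha beta gamma omega lambda kappa n L M F Gp W X1 N Rr S HS BS : R) :
  0 < alpha -> alpha <= 1 -> 0 < gamma -> 0 <= omega -> 0 < n ->
  0 < L -> 100 * L * gamma <= alpha -> 160 * omega * gamma * M <= n ->
  beta = (omega + 1)^-1 ->
  0 <= F -> 0 <= Gp -> 0 <= W -> 0 <= HS -> 0 <= BS ->
  X1 <= (1 + alpha / 2) * W + (1 + (alpha / 2)^-1) * (gamma ^+ 2 * N) ->
  N <= 2 * L * Gp ->
  S <= 2 * HS + 2 * BS ->
  BS <= 2 * n * M * Gp ->
  Gp <= 2 * F + L * W ->
  lambda = 2 * L / alpha ->
  kappa = 8 * gamma * omega * (omega + 1) / n ^+ 2 ->
  (L / 2 + lambda * (1 - alpha)) * (X1 + (gamma / n) ^+ 2 * omega * S)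
  + (2 * gamma)^-1 * (Rr + (gamma / n) ^+ 2 * omega * S)
  + kappa * ((1 - beta) * HS + beta * BS)
  <= (2 * gamma)^-1 * Rr + kappa * HS + lambda * W + 2^-1 * F.
Proof.
move=> a0 a1 g0 o0 n0 L0 Lg Mg bE F0 G0 W0 HS0 BS0 hX hN hS hB hG lE kE.
pose c1 := L / 2 + lambda * (1 - alpha).
have an0 : alpha != 0 by rewrite gt_eqF.
have gn0 : gamma != 0 by rewrite gt_eqF.
have nn0 : n != 0 by rewrite gt_eqF.
have on0 : omega + 1 != 0 by rewrite gt_eqF// ltr_wpDl.
(* The two stepsize conditions enter only as [e <= 1 / 100] and, through [theta] below, as
   [theta * (2 * n * M) <= 1 / 80]. *)
pose e := L * gamma / alpha.
have e0 : 0 < e by rewrite divr_gt0// mulr_gt0.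
have e1 : e <= 1 / 100.
  by rewrite ler_pdivrMr//; move: Lg; lra.
pose theta := gamma * omega / n ^+ 2.
have t0 : 0 <= theta.
  by apply: divr_ge0; [apply: mulr_ge0 => //; exact: ltW|exact: sqr_ge0].
have La : L <= L / alpha by rewrite ler_pdivlMr// ger_pMr.
have c10 : 0 <= c1.
  apply: addr_ge0; first by rewrite divr_ge0// ltW.
  apply: mulr_ge0; last by rewrite subr_ge0.
  rewrite lE.
  by apply: divr_ge0; [apply: mulr_ge0 => //|]; exact: ltW.
have c1E : c1 = 2 * (L / alpha) - 3 / 2 * L by rewrite /c1 lE; field.
(* The value of lambda is chosen for this identity: after inflation by 1 + alpha/2 the weight is
   still below lambda by more than L/2. *)
have T1 : c1 * ((1 + alpha / 2) * W) =
    lambda * W - 1 / 2 * (L * W) - 3 / 4 * (L * alpha * W).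
  by rewrite /c1 lE; field.
have c1le : c1 <= 2 * (L / alpha) by rewrite c1E; lra.
have h0 : 0 <= 1 + (alpha / 2)^-1.
  by rewrite addr_ge0// invr_ge0 divr_ge0// ltW.
(* Both factors are of order 1/alpha, and the product is at most 12 e^2. Hence L gamma has to be
   small relative to alpha. *)
have T2 : c1 * (1 + (alpha / 2)^-1) * (gamma ^+ 2 * (2 * L)) <= 12 / 10000.
  have h : 1 + (alpha / 2)^-1 <= 3 / alpha.
    by rewrite ler_pdivlMr// mulrDl invf_div divfK//; lra.
  have := ler_pM c10 h0 c1le h => h'.
  have g2 : 0 <= gamma ^+ 2 * (2 * L).
    by apply: mulr_ge0; [exact: sqr_ge0|apply: mulr_ge0 => //; exact: ltW].
  apply: le_trans (ler_wpM2r g2 h') _.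
  have -> :
      2 * (L / alpha) * (3 / alpha) * (gamma ^+ 2 * (2 * L)) = 12 * e ^+ 2.
    by rewrite /e; field.
  have : e ^+ 2 <= (1 / 100) ^+ 2 by rewrite lerXn2r// nnegrE; lra.
  lra.
have T3 : (c1 + (2 * gamma)^-1) * ((gamma / n) ^+ 2 * omega)
    = (c1 * gamma + 1 / 2) * theta.
  rewrite /theta; move: c1 {c10 c1E T1 c1le T2} => c1.
  by field; rewrite nn0 gn0.
have c1g : c1 * gamma <= 2 / 100.
  have : c1 * gamma <= 2 * (L / alpha) * gamma by rewrite ler_wpM2r// ltW.
  have -> : 2 * (L / alpha) * gamma = 2 * e by rewrite /e; field.
  lra.
have T4 : kappa * beta = 8 * theta.
  by rewrite kE /theta bE; field; rewrite on0 nn0.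
have T5 : theta * (2 * n * M) <= 1 / 80.
  have -> : theta * (2 * n * M) = 2 * (gamma * omega * M) / n.
    by rewrite /theta; field.
  by rewrite ler_pdivrMr//; move: Mg; lra.
have U1 : theta * BS <= 1 / 80 * Gp.
  apply: le_trans (ler_wpM2l t0 hB) _; rewrite mulrA.
  exact: ler_wpM2r.
have U2 : (c1 * gamma + 1 / 2) * theta * S
    <= 104 / 100 * (theta * HS + theta * BS).
  have cg0 : 0 <= c1 * gamma by rewrite mulr_ge0// ltW.
  have h : 0 <= (c1 * gamma + 1 / 2) * theta by apply: mulr_ge0 => //; lra.
  apply: le_trans (ler_wpM2l h hS) _.
  have : (c1 * gamma + 1 / 2) * (theta * (HS + BS))
      <= 52 / 100 * (theta * (HS + BS)).
    by apply: ler_wpM2r; [apply: mulr_ge0 => //; exact: addr_ge0|lra].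
  lra.
have U3 : c1 * X1 <= c1 * ((1 + alpha / 2) * W) + 12 / 10000 * Gp.
  apply: le_trans (ler_wpM2l c10 hX) _; rewrite mulrDr lerD2l mulrA.
  have : c1 * (1 + (alpha / 2)^-1) * (gamma ^+ 2 * N)
      <= c1 * (1 + (alpha / 2)^-1) * (gamma ^+ 2 * (2 * L * Gp)).
    apply: ler_wpM2l; first exact: mulr_ge0.
    by apply: ler_wpM2l => //; exact: sqr_ge0.
  move=> /le_trans; apply.
  by have := ler_wpM2r G0 T2; rewrite -!mulrA.
have LaW : 0 <= L * alpha * W.
  by apply: mulr_ge0 => //; apply: mulr_ge0; exact: ltW.
have LW : 0 <= L * W by apply: mulr_ge0 => //; exact: ltW.
have tH : 0 <= theta * HS by exact: mulr_ge0.
have E : c1 * (X1 + (gamma / n) ^+ 2 * omega * S)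
  + (2 * gamma)^-1 * (Rr + (gamma / n) ^+ 2 * omega * S)
  + kappa * ((1 - beta) * HS + beta * BS) =
  c1 * X1 + (2 * gamma)^-1 * Rr
  + (c1 + (2 * gamma)^-1) * ((gamma / n) ^+ 2 * omega) * S
  + kappa * HS - kappa * beta * HS + kappa * beta * BS.
  clear; clearbody c1.
  by move: ((2 * gamma)^-1) ((gamma / n) ^+ 2 * omega) => z2 z3; ring.
(* The coefficient of Gp is 0.0012 + 1.04/80 + 8/80 < 0.12, and Gp <= 2 F + L W fits into F/2 and
   the L W / 2 of [T1]. The shift sum gets 1.04 theta against a loss of 8 theta. *)
rewrite -/c1 E T3 T4; move: U1 U2 U3; rewrite T1.
clear - F0 G0 W0 HS0 BS0 hG LaW LW tH.
move: (c1 * X1) ((c1 * gamma + 1 / 2) * theta * S) ((2 * gamma)^-1 * Rr)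
  (kappa * HS) (lambda * W) => z1 z2 z3 z4 z5.
lra.
Qed.

Section one_step.
Context {R : realType} {d n : nat} (n_gt0 : (0 < n)%N)
  (f : 'rV[R]_d -> R) (fi : 'I_n -> 'rV[R]_d -> R)
  (fE : forall x, f x = n%:R^-1 * \sum_(i < n) fi i x)
  (L M : R) (L_gt0 : 0 < L) (M_gt0 : 0 < M)
  (f_smooth : smooth_with L f) (fi_smooth : forall i, smooth_with M (fi i))
  (fi_convex : forall i, first_order_convex (fi i))
  (xstar : 'rV[R]_d) (xstar_min : forall x, f xstar <= f x).

Let n0 : 0 < n%:R :> R. Proof. by rewrite ltr0n. Qed.
Let fi_diff i x : differentiable (fi i) x. Proof. by case: (fi_smooth i). Qed.

(** In the sum of the Bregman bounds at xstar the linear terms vanish, since the gradients of the fi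
    at xstar add up to zero. *)
Lemma sum_bregman_le w :
  \sum_(i < n) dot (gradient (fi i) w - gradient (fi i) xstar)
                   (gradient (fi i) w - gradient (fi i) xstar)
    <= 2 * n%:R * M * (f w - f xstar).
Proof.
have sum_grad : \sum_(i < n) gradient (fi i) xstar = 0.
  have := gradient_minimum L_gt0 f_smooth xstar_min.
  rewrite (gradient_average fE fi_diff) /average => /eqP.
  by rewrite scaler_eq0 invr_eq0 gt_eqF//= => /eqP.
apply: le_trans (_ : \sum_(i < n) (2 * M * (fi i w - fi i xstar
    - dot (gradient (fi i) xstar) (w - xstar))) <= _).
  by apply: ler_sum => i _; exact: bregman_lower_bound.
rewrite -mulr_sumr !sumrB -dot_suml sum_grad dot0l subr0 !fE -mulrBr.
rewrite le_eqVlt; apply/orP; left; apply/eqP.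
by field; rewrite gt_eqF.
Qed.

(** Descent and convexity, both at w, leave <q, x' - xstar> with q = grad f(w) and x' the new point.
    Since x' - xstar = y - gamma q with y = x - xstar + D, expanding |y - gamma q|^2 / (2 gamma)
    produces the same inner product with the opposite sign, and the remainder -gamma/2 |q|^2 is
    dropped. Nothing is averaged here, so D may be any vector. *)
Lemma objective_step (gamma : R) (x w D : 'rV[R]_d) : 0 < gamma ->
  f (x - gamma *: gradient f w + D) - f xstar
  + (2 * gamma)^-1 * dot (x - gamma *: gradient f w + D - xstar)
                         (x - gamma *: gradient f w + D - xstar)
  <= L / 2 * dot (x - gamma *: gradient f w - w + D)
                 (x - gamma *: gradient f w - w + D)
     + (2 * gamma)^-1 * dot (x - xstar + D) (x - xstar + D).
Proof.
move=> g0; set x' := x - gamma *: _ + D.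
have := descent w x' L_gt0 f_smooth.
have := first_order_convex_average n_gt0 fE fi_diff fi_convex w xstar.
rewrite /x'; move: (gradient f w) => q {x'}.
set y := x - xstar + D; move: (f (_ + D)) (f w) (f xstar) => fx' fw fs.
have -> : x - gamma *: q + D - w = x - gamma *: q - w + D by rewrite addrAC.
have -> : x - gamma *: q + D - xstar = y - gamma *: q.
  by rewrite /y [LHS]addrAC [x - _ - xstar]addrAC [RHS]addrAC.
move: (L / 2 * _) => Q h1 h2.
have h3 : dot q (x - gamma *: q - w + D) =
    dot q (y - gamma *: q) + dot q (xstar - w).
  by rewrite /y !dotE; ring.
have h4 : (2 * gamma)^-1 * dot (y - gamma *: q) (y - gamma *: q) =
    (2 * gamma)^-1 * dot y y - dot q (y - gamma *: q) - gamma / 2 * dot q q.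
  by move: y {h1 h2 h3} => y; rewrite !dotE (dotC y q); field; rewrite gt_eqF.
have : 0 <= gamma / 2 * dot q q.
  by apply: mulr_ge0; [rewrite divr_ge0// ltW|exact: dot_ge0].
by move: h2; rewrite h3 h4; lra.
Qed.

Lemma lyapunov_step (alpha beta gamma omega lambda kappa : R)
    (x w y : 'rV[R]_d) (h v a : 'I_n -> 'rV[R]_d) :
  0 < alpha -> alpha <= 1 -> 0 < gamma -> 0 <= omega ->
  100 * L * gamma <= alpha -> 160 * omega * gamma * M <= n%:R ->
  beta = (omega + 1)^-1 -> lambda = 2 * L / alpha ->
  kappa = 8 * gamma * omega * (omega + 1) / n%:R ^+ 2 ->
  (forall i, v i = gradient (fi i) w - h i) ->
  (forall i, a i = h i - gradient (fi i) xstar) ->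
  y = x - gamma *: gradient f w - w ->
  (L / 2 + lambda * (1 - alpha)) *
    (dot y y + (gamma / n%:R) ^+ 2 * omega * \sum_(i < n) dot (v i) (v i))
  + (2 * gamma)^-1 * (dot (x - xstar) (x - xstar)
      + (gamma / n%:R) ^+ 2 * omega * \sum_(i < n) dot (v i) (v i))
  + kappa * \sum_(i < n) (dot (a i + beta *: v i) (a i + beta *: v i)
      + beta ^+ 2 * omega * dot (v i) (v i))
  <= (2 * gamma)^-1 * dot (x - xstar) (x - xstar)
     + kappa * (\sum_(i < n) dot (a i) (a i))
     + lambda * dot (w - x) (w - x) + 2^-1 * (f x - f xstar).
Proof.
move=> a0 a1 g0 o0 Lg Mg bE lE kE vE' aE yE'.
pose b i := gradient (fi i) w - gradient (fi i) xstar.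
have vE i : v i = b i - a i by rewrite vE' /b aE opprB addrA subrK.
(* For beta = 1/(omega + 1) one has beta^2 omega = beta (1 - beta), so the variance exactly cancels
   the convexity defect of the square of (1 - beta) a + beta b. *)
have -> : \sum_(i < n) (dot (a i + beta *: v i) (a i + beta *: v i)
      + beta ^+ 2 * omega * dot (v i) (v i)) =
    (1 - beta) * (\sum_(i < n) dot (a i) (a i))
    + beta * (\sum_(i < n) dot (b i) (b i)).
  rewrite !mulr_sumr -big_split/=; apply: eq_bigr => i _; rewrite vE.
  move: (a i) (b i) => ai bi; rewrite !dotE (dotC bi ai) bE; field.
  by rewrite gt_eqF// ltr_wpDl.
have yE : y = (x - w) + - (gamma *: gradient f w) by rewrite yE' addrAC.
have hy : dot y y <= (1 + alpha / 2) * dot (w - x) (w - x) +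
    (1 + (alpha / 2)^-1) * (gamma ^+ 2 * dot (gradient f w) (gradient f w)).
  have /(dotD_young (x - w) (- (gamma *: gradient f w))) : 0 < alpha / 2.
    by rewrite divr_gt0.
  rewrite -yE -(opprB w x) !dotNl !dotNr !opprK dotZl dotZr.
  by rewrite [gamma * (gamma * _)]mulrA -expr2.
apply: (lyapunov_coefficients (M := M) _ a0 a1 g0 o0 n0 L_gt0 Lg Mg bE _ _ _ _ _
  hy (gradient_le_gap w L_gt0 f_smooth xstar_min) _ (sum_bregman_le w) _ lE kE).
- by rewrite subr_ge0.
- by rewrite subr_ge0.
- exact: dot_ge0.
- by apply: sumr_ge0 => i _; exact: dot_ge0.
- by apply: sumr_ge0 => i _; exact: dot_ge0.
- rewrite !mulr_sumr addrC -big_split/=; apply: ler_sum => i _.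
  by rewrite vE; exact: dotB_le.
- exact: gap_le.
Qed.

End one_step.

(** * The iterates as a random process *)

Lemma generated_events_measurable (d1 d2 : measure_display)
    (T : measurableType d1) (S : measurableType d2) (X : {mfun T >-> S}) :
  generated_events X `<=` measurable.
Proof. by move=> _ [A mA <-]; exact: measurable_funP. Qed.

Lemma generated_events_setI (d1 d2 : measure_display)
    (T : measurableType d1) (S : measurableType d2) (X : T -> S) :
  setI_closed (generated_events X).
Proof.
move=> _ _ [A mA <-] [B mB <-]; exists (A `&` B); first exact: measurableI.
by rewrite !setTI preimage_setI.
Qed.

Lemma generated_events_setT (d1 d2 : measure_display)
    (T : measurableType d1) (S : measurableType d2) (X : T -> S) :
  generated_events X setT.
Proof. by exists setT; rewrite // setTI. Qed.

Section diana_process.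
Context {R : realType} {d n : nat} (n_gt0 : (0 < n)%N)
  (f : 'rV[R]_d -> R) (fi : 'I_n -> 'rV[R]_d -> R)
  (fE : forall x, f x = n%:R^-1 * \sum_(i < n) fi i x)
  (L M : R) (L_gt0 : 0 < L) (M_gt0 : 0 < M)
  (f_smooth : smooth_with L f) (fi_smooth : forall i, smooth_with M (fi i))
  (fi_convex : forall i, first_order_convex (fi i))
  (xstar : 'rV[R]_d) (xstar_min : forall x, f xstar <= f x)
  (omega alpha : R) (omega_ge0 : 0 <= omega)
  (alpha_gt0 : 0 < alpha) (alpha_le1 : alpha <= 1)
  (CD : 'I_n -> stochastic_map R d) (CP : stochastic_map R d)
  (CD_unbiased : forall i, unbiased_compressor omega (CD i))
  (CP_contractive : contractive_compressor alpha CP)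
  (disp : measure_display) (Omega : measurableType disp)
  (P : probability Omega R)
  (xiD : nat -> forall i : 'I_n, {mfun Omega >-> seed (CD i)})
  (xiP : nat -> {mfun Omega >-> seed CP})
  (draws : independent_draws P xiD xiP)
  (x0 : 'rV[R]_d) (h0 : 'I_n -> 'rV[R]_d)
  (beta gamma : R) (betaE : beta = (omega + 1)^-1) (gamma_gt0 : 0 < gamma)
  (gamma_L : 100 * L * gamma <= alpha)
  (gamma_M : 160 * omega * gamma * M <= n%:R).

Let index : eqType := (nat * option 'I_n)%type.

Let G (k : index) : set (set Omega) :=
  if k.2 is Some i then generated_events (xiD k.1 i)
  else generated_events (xiP k.1).

Let Gm k : G k `<=` measurable.
Proof. by case: k => t [i|]; exact: generated_events_measurable. Qed.

Let GI k : setI_closed (G k).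
Proof. by case: k => t [i|]; exact: generated_events_setI. Qed.

Let GT k : G k setT.
Proof. by case: k => t [i|]; exact: generated_events_setT. Qed.

Let indep : mutually_independent P G. Proof. by case: draws. Qed.

Let D_law t i (A : set (seed (CD i))) : measurable A ->
  distribution P (xiD t i) A = seed_law (CD i) A.
Proof. by case: draws => h _ _; exact: h. Qed.

Let P_law t (A : set (seed CP)) : measurable A ->
  distribution P (xiP t) A = seed_law CP A.
Proof. by case: draws => _ h _; exact: h. Qed.

Let st t w := diana gamma beta fi xiD xiP x0 h0 t w.
Let xt t w := st_x (st t w).
Let wt t w := st_w (st t w).
Let ht t i w := st_hi (st t w) i.
Let v t i w := gradient (fi i) (wt t w) - ht t i w.
Let err t i w := CD i (xiD t i w) (v t i w) - v t i w.

Let fi_diff i x : differentiable (fi i) x. Proof. by case: (fi_smooth i). Qed.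

Let averageE (u : 'I_n -> 'rV[R]_d) : average u = n%:R^-1 *: \sum_(i < n) u i.
Proof. by []. Qed.

(** Invariant that turns g^t into the mean of the gradients at w_t plus the mean of the worker
    errors. *)
Lemma st_h_average t w : st_h (st t w) = average (ht t ^~ w).
Proof.
elim: t => [//|t ih]; rewrite /st /= -/(st t w) ih !averageE.
rewrite scalerA (mulrC beta) -scalerA -scalerDr scaler_sumr -big_split.
by congr (_ *: _); apply: eq_bigr.
Qed.

Lemma st_xS t w : xt t.+1 w = xt t w - gamma *: gradient f (wt t w)
  + (- (gamma / n%:R)) *: \sum_(i < n) err t i w.
Proof.
rewrite /xt /st /= -/(st t w) st_h_average (gradient_average fE fi_diff).
rewrite !averageE -scalerDr -big_split/= scaleNr -scalerA -addrA -opprD.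
rewrite -scalerDr -scalerDr -big_split/=; congr (_ - _ *: (_ *: _)).
apply: eq_bigr => i _; rewrite /err /v addrA addrAC.
by rewrite opprB addrCA subrr addr0 addrC.
Qed.

Lemma st_wS t w : wt t.+1 w = wt t w + CP (xiP t w) (xt t.+1 w - wt t w).
Proof. by []. Qed.

Lemma st_hiS t i w :
  ht t.+1 i w = ht t i w + beta *: v t i w + beta *: err t i w.
Proof.
by rewrite -addrA -scalerDr /err [v t i w + _]addrC subrK.
Qed.

Let before t : set index := [set k | (k.1 < t)%N].
(** Earlier rounds together with the first m workers of round t. For m = n this determines x_{t+1}
    while the draw of the primal compressor is still fresh. *)
Let during t m : set index :=
  [set k | (k.1 < t)%N \/
    k.1 = t /\ exists2 i : 'I_n, k.2 = Some i & (i < m)%N].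

Let mpast K (X : Omega -> 'rV[R]_d) :=
  measurable_fun [set: past G K] (X : past G K -> borel_rV R d).

Let mpast_sub K K' X : K `<=` K' -> mpast K X -> mpast K' X.
Proof.
move=> KK' mX.
exact: (measurableT_comp mX (@measurable_past_sub _ Omega _ G _ _ KK')).
Qed.

Let mpast_cst K (x : 'rV[R]_d) : mpast K (fun=> x).
Proof. exact: (@measurable_cst _ _ (past G K) (borel_rV R d)). Qed.

Let mpast_grad K g X (C : R) : smooth_with C g -> mpast K X ->
  mpast K (fun w => gradient g (X w)).
Proof. by move=> /measurable_gradient/measurableT_comp; apply. Qed.

Let mpastB K X Y : mpast K X -> mpast K Y -> mpast K (fun w => X w - Y w).
Proof. exact: measurable_rVB. Qed.

Let mpast_draw K t i (X : Omega -> 'rV[R]_d) : K (t, Some i) -> mpast K X ->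
  mpast K (fun w => CD i (xiD t i w) (X w)).
Proof. by move=> Kk mX; exact: (measurable_compress (k := (t, Some i))). Qed.

Let mpast_drawP K t (X : Omega -> 'rV[R]_d) : K (t, None) -> mpast K X ->
  mpast K (fun w => CP (xiP t w) (X w)).
Proof. by move=> Kk mX; exact: (measurable_compress (k := (t, None))). Qed.

Let mv_of K t i : mpast K (wt t) -> mpast K (ht t i) -> mpast K (v t i).
Proof.
by move=> mw mh; apply: measurable_rVB => //; exact: mpast_grad mw.
Qed.

Let merr_of K t i : K (t, Some i) -> mpast K (v t i) -> mpast K (err t i).
Proof. by move=> Kk mv; apply: measurable_rVB => //; exact: mpast_draw. Qed.

(** Stated for any K because x_{t+1} is needed both in [before t.+1] and in the smaller
    [during t n]. *)
Let mx_of K t : (forall i, K (t, Some i)) -> mpast K (xt t) -> mpast K (wt t) ->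
  (forall i, mpast K (ht t i)) -> mpast K (xt t.+1).
Proof.
move=> Kk mx mw mh; rewrite /mpast (funext (st_xS t)).
apply: measurable_rVD.
  apply: measurable_rVB => //; apply: measurable_rVZ.
  exact: (mpast_grad f_smooth mw).
apply: measurable_rVZ; apply: measurable_rV_sum => i.
by apply: merr_of => //; exact: mv_of.
Qed.

Lemma state_measurable t :
  [/\ mpast (before t) (xt t), mpast (before t) (wt t) &
      forall i, mpast (before t) (ht t i)].
Proof.
elim: t => [|t [mx mw mh]]; first by split=> [||i]; exact: mpast_cst.
have sub : before t `<=` before t.+1 by move=> k /= /ltnW.
have {}mx := mpast_sub sub mx; have {}mw := mpast_sub sub mw.
have {}mh i := mpast_sub sub (mh i).
have mx' : mpast (before t.+1) (xt t.+1).
  by apply: mx_of => // i; rewrite /before /=.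
split=> // [|i].
  rewrite /mpast (funext (st_wS t)).
  apply: measurable_rVD => //; apply: mpast_drawP; first by rewrite /before /=.
  exact: measurable_rVB.
rewrite /mpast (funext (st_hiS t i)).
have mvi : mpast (before t.+1) (v t i) by exact: mv_of.
apply: measurable_rVD; last first.
  by apply: measurable_rVZ; apply: merr_of => //; rewrite /before /=.
apply: measurable_rVD.
  exact: mh.
exact: (measurable_rVZ beta mvi).
Qed.

Let nonneg_dot (X : Omega -> 'rV[R]_d) K : mpast K X ->
  nonneg_rv (fun w => dot (X w) (X w)).
Proof.
move=> mX; split=> [|w]; last exact: dot_ge0.
have mX' : measurable_fun setT (X : Omega -> borel_rV R d).
  exact: (measurable_past Gm mX).
exact: measurable_dot.
Qed.

(* The errors of one round are integrated out one worker at a time. *)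
Lemma mean_le_batch_prefix t m (c : R) (A : Omega -> 'rV[R]_d) : (m <= n)%N ->
  mpast (before t) A ->
  mean_le P
    (fun w => dot (A w + c *: \sum_(i < n | (i < m)%N) err t i w)
                  (A w + c *: \sum_(i < n | (i < m)%N) err t i w))
    (fun w => dot (A w) (A w)
      + c ^+ 2 * omega * \sum_(i < n | (i < m)%N) dot (v t i w) (v t i w)).
Proof.
move=> mn mA; have [mx mw mh] := state_measurable t.
have mv i : mpast (before t) (v t i) by exact: mv_of.
have co : 0 <= c ^+ 2 * omega by rewrite mulr_ge0 ?sqr_ge0.
elim: m mn => [|m ih] mn.
  apply: mean_le_pointwise.
  - by under eq_fun do rewrite big_pred0// scaler0 addr0; exact: nonneg_dot mA.
  - by under eq_fun do rewrite big_pred0// mulr0 addr0; exact: nonneg_dot mA.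
  - by move=> w; rewrite !big_pred0// scaler0 mulr0 !addr0.
pose j := Ordinal mn.
have splitE (V : nmodType) (F : 'I_n -> V) : \sum_(i < n | (i < m.+1)%N) F i =
    \sum_(i < n | (i < m)%N) F i + F j.
  rewrite (bigD1 j)//= addrC; congr (_ + _); apply: eq_bigl => i.
  by rewrite ltnS ltn_neqAle andbC.
have sub : before t `<=` during t m by move=> k /= kt; left.
have mA' : mpast (during t m)
    (fun w => A w + c *: \sum_(i < n | (i < m)%N) err t i w).
  apply: measurable_rVD; first exact: mpast_sub mA.
  apply: (measurable_rVZ c (X := fun w : past G (during t m) =>
    \sum_(i < n | (i < m)%N) err t i w)).
  rewrite (_ : (fun w => _) = fun w => \sum_(i < n)
      if (i < m)%N then err t i w else 0); last first.
    by apply/funext => w; rewrite big_mkcond.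
  apply: (@measurable_rV_sum _ _ _ _ _ _ xpredT) => i.
  case im : (i < m)%N; last exact: mpast_cst.
  apply: merr_of; last exact: mpast_sub (mv i).
  by right; split => //; exists i.
have njd : ~ during t m (t, Some j).
  by case=> [|[_ [i [ji] im]]]; [rewrite /= ltnn|move: im; rewrite -ji /= ltnn].
have step := mean_le_unbiased Gm GI GT indep (k := (t, Some j))
  (K := during t m) (C := CD j) (X := xiD t j) (@D_law t j) erefl njd c
  omega_ge0 (CD_unbiased j) mA' (mpast_sub sub (mv j)).
under eq_fun do rewrite splitE scalerDr addrA.
under [X in mean_le _ _ X]eq_fun do rewrite splitE mulrDr addrA.
apply: mean_le_trans step _.
apply: mean_leD; first exact: ih (ltnW mn).
by apply/mean_le_refl/nonneg_rvZ => //; exact: nonneg_dot (mv j).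
Qed.

Lemma mean_le_batch t (c : R) (A : Omega -> 'rV[R]_d) : mpast (before t) A ->
  mean_le P
    (fun w => dot (A w + c *: \sum_(i < n) err t i w)
                  (A w + c *: \sum_(i < n) err t i w))
    (fun w => dot (A w) (A w)
              + c ^+ 2 * omega * \sum_(i < n) dot (v t i w) (v t i w)).
Proof.
move=> mA; have := mean_le_batch_prefix c (leqnn n) mA.
have E (V : nmodType) (F : 'I_n -> V) :
    \sum_(i < n | (i < n)%N) F i = \sum_(i < n) F i.
  by apply: eq_bigl => i; rewrite ltn_ord.
by under eq_fun do rewrite E; under [X in mean_le _ _ X]eq_fun do rewrite E.
Qed.

Lemma mean_le_worker t i (c : R) (A : Omega -> 'rV[R]_d) : mpast (before t) A ->
  mean_le P
    (fun w => dot (A w + c *: err t i w) (A w + c *: err t i w))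
    (fun w => dot (A w) (A w) + c ^+ 2 * omega * dot (v t i w) (v t i w)).
Proof.
move=> mA; have [mx mw mh] := state_measurable t.
have nbi : ~ before t (t, Some i) by rewrite /before /= ltnn.
exact: (mean_le_unbiased Gm GI GT indep (k := (t, Some i)) (K := before t)
  (C := CD i) (X := xiD t i) (@D_law t i) erefl nbi c omega_ge0
  (CD_unbiased i) mA (mv_of mw (mh i))).
Qed.

(** w_{t+1} - x_{t+1} is the error made in compressing x_{t+1} - w_t, an input that depends on all
    worker draws of round t; hence the past [during t n]. *)
Lemma mean_le_primal t :
  mean_le P
    (fun w => dot (wt t.+1 w - xt t.+1 w) (wt t.+1 w - xt t.+1 w))
    (fun w => (1 - alpha) * dot (xt t.+1 w - wt t w) (xt t.+1 w - wt t w)).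
Proof.
have [mx mw mh] := state_measurable t.
have sub : before t `<=` during t n by move=> k /= kt; left.
have nd : ~ during t n (t, None) by case=> /= [|[_ [i]]]; rewrite ?ltnn.
have mx' : mpast (during t n) (xt t.+1).
  apply: mx_of => [i|||i]; [|exact: mpast_sub mx|exact: mpast_sub mw|].
    by right; split=> //; exists i.
  exact: mpast_sub (mh i).
have md : mpast (during t n) (fun w => xt t.+1 w - wt t w).
  by apply: measurable_rVB => //; exact: mpast_sub mw.
have := mean_le_contractive Gm GI GT indep (k := (t, None)) (K := during t n)
  (C := CP) (X := xiP t) (@P_law t) erefl nd alpha_le1 CP_contractive md.
rewrite (_ : (fun w => dot (wt t.+1 w - _) _) = fun w =>
    dot (CP (xiP t w) (xt t.+1 w - wt t w) - (xt t.+1 w - wt t w))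
        (CP (xiP t w) (xt t.+1 w - wt t w) - (xt t.+1 w - wt t w))) //.
apply/funext => w; rewrite st_wS.
suff -> : wt t w + CP (xiP t w) (xt t.+1 w - wt t w) - xt t.+1 w =
  CP (xiP t w) (xt t.+1 w - wt t w) - (xt t.+1 w - wt t w) by [].
move: (CP _ _) => p; move: (xt t.+1 w) (wt t w) => q r.
by rewrite opprB addrA [r + p]addrC.
Qed.

Let lambda : R := 2 * L / alpha.
Let kappa : R := 8 * gamma * omega * (omega + 1) / n%:R ^+ 2.
Let a t i w := ht t i w - gradient (fi i) xstar.
Let gap t w : R := f (xt t w) - f xstar.
Let lyapunov t w : R := (2 * gamma)^-1 * dot (xt t w - xstar) (xt t w - xstar)
  + kappa * (\sum_(i < n) dot (a t i w) (a t i w))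
  + lambda * dot (wt t w - xt t w) (wt t w - xt t w).

Let lambda_ge0 : 0 <= lambda.
Proof. by apply: divr_ge0; [apply: mulr_ge0 => //|]; exact: ltW. Qed.

Let kappa_ge0 : 0 <= kappa.
Proof.
apply: divr_ge0; last exact: sqr_ge0.
by rewrite !mulr_ge0 ?addr_ge0// ltW.
Qed.

Let gamma2_ge0 : 0 <= (2 * gamma)^-1.
Proof. by rewrite invr_ge0 mulr_ge0// ltW. Qed.

Let nonneg_gap t : nonneg_rv (gap t).
Proof.
have [mx _ _] := state_measurable t.
split=> [|w]; last by rewrite subr_ge0.
apply: measurable_funB => //.
exact: (measurableT_comp (measurable_smooth f_smooth) (measurable_past Gm mx)).
Qed.

Let nonneg_lyapunov t : nonneg_rv (lyapunov t).
Proof.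
have [mx mw mh] := state_measurable t.
apply: nonneg_rvD; first apply: nonneg_rvD; apply: nonneg_rvZ => //.
- exact: (nonneg_dot (@mpastB _ _ _ mx (@mpast_cst _ xstar))).
- apply: nonneg_rv_sum => i.
  exact: (nonneg_dot (@mpastB _ _ _ (mh i) (@mpast_cst _ _))).
- exact: (nonneg_dot (@mpastB _ _ _ mw mx)).
Qed.

Lemma lyapunov_mean_step t :
  mean_le P (fun w => lyapunov t.+1 w + gap t.+1 w)
            (fun w => lyapunov t w + 2^-1 * gap t w).
Proof.
have [mx mw mh] := state_measurable t.
pose c := - (gamma / n%:R).
pose y w := xt t w - gamma *: gradient f (wt t w) - wt t w.
pose z w := xt t w - xstar.
pose u i w := a t i w + beta *: v t i w.
have my : mpast (before t) y.
  apply: (@mpastB _ _ _ _ mw); apply: (@mpastB _ _ _ mx).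
  exact: (measurable_rVZ gamma (mpast_grad f_smooth mw)).
have mz : mpast (before t) z := @mpastB _ _ _ mx (@mpast_cst _ xstar).
have mu i : mpast (before t) (u i).
  apply: measurable_rVD; first exact: (@mpastB _ _ _ (mh i) (@mpast_cst _ _)).
  exact: (measurable_rVZ beta (mv_of mw (mh i))).
pose Q1 w := dot (y w + c *: \sum_(i < n) err t i w)
                 (y w + c *: \sum_(i < n) err t i w).
pose Q2 w := dot (z w + c *: \sum_(i < n) err t i w)
                 (z w + c *: \sum_(i < n) err t i w).
pose R' w := dot (xt t.+1 w - xstar) (xt t.+1 w - xstar).
pose H' w := \sum_(i < n) dot (a t.+1 i w) (a t.+1 i w).
pose W' w := dot (wt t.+1 w - xt t.+1 w) (wt t.+1 w - xt t.+1 w).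
have hQ1 := mean_le_batch c my; rewrite -/Q1 in hQ1.
have hQ2 := mean_le_batch c mz; rewrite -/Q2 in hQ2.
have hH : mean_le P H' (fun w => \sum_(i < n) (dot (u i w) (u i w)
    + beta ^+ 2 * omega * dot (v t i w) (v t i w))).
  rewrite (_ : H' = fun w => \sum_(i < n)
    dot (u i w + beta *: err t i w) (u i w + beta *: err t i w)).
    by apply: mean_le_sum => i; exact: mean_le_worker.
  apply/funext => w; apply: eq_bigr => i _.
  have -> : a t.+1 i w = u i w + beta *: err t i w; last by [].
  by rewrite /a st_hiS /u /a addrAC; congr (_ + _); rewrite addrAC.
have hW : mean_le P W' (fun w => (1 - alpha) * Q1 w).
  have := mean_le_primal t; rewrite -/W'.
  suff -> : (fun w =>
      (1 - alpha) * dot (xt t.+1 w - wt t w) (xt t.+1 w - wt t w)) =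
      (fun w => (1 - alpha) * Q1 w) by [].
  apply/funext => w; rewrite /Q1 /y st_xS.
  by rewrite addrAC.
have nQ1 : nonneg_rv Q1 by case: hQ1.
have nQ2 : nonneg_rv Q2 by case: hQ2.
have nR : nonneg_rv R'.
  have [mx' _ _] := state_measurable t.+1.
  exact: (nonneg_dot (@mpastB _ _ _ mx' (@mpast_cst _ xstar))).
have L2 : 0 <= L / 2 by rewrite divr_ge0// ltW.
(* This bound is pointwise. [Q1] = |x_{t+1} - w_t|^2 stays intact so that its share L/2 and the
   share lambda (1 - alpha) from the primal error can be merged before the workers are averaged
   out. *)
have hX : mean_le P (fun w => gap t.+1 w + (2 * gamma)^-1 * R' w)
    (fun w => L / 2 * Q1 w + (2 * gamma)^-1 * Q2 w).
  apply: mean_le_pointwise.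
  - by apply: nonneg_rvD => //; exact: nonneg_rvZ.
  - by apply: nonneg_rvD; exact: nonneg_rvZ.
  - move=> w; rewrite /gap /R' st_xS.
    exact: (objective_step n_gt0 fE L_gt0 f_smooth fi_smooth fi_convex).
have h1 := mean_leD (mean_leD hX (mean_leZ kappa_ge0 hH))
  (mean_leZ lambda_ge0 hW).
have C1 : 0 <= L / 2 + lambda * (1 - alpha).
  by rewrite addr_ge0// mulr_ge0// subr_ge0.
have hS : mean_le P (fun w => \sum_(i < n) (dot (u i w) (u i w)
    + beta ^+ 2 * omega * dot (v t i w) (v t i w)))
  (fun w => \sum_(i < n) (dot (u i w) (u i w)
    + beta ^+ 2 * omega * dot (v t i w) (v t i w))).
  by apply: mean_le_refl; case: hH.
have h2 := mean_leD (mean_leD (mean_leZ C1 hQ1) (mean_leZ gamma2_ge0 hQ2))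
  (mean_leZ kappa_ge0 hS).
have E1 : (fun w => lyapunov t.+1 w + gap t.+1 w) = (fun w =>
    gap t.+1 w + (2 * gamma)^-1 * R' w + kappa * H' w + lambda * W' w).
  apply/funext => w; rewrite /lyapunov -/(R' w) -/(H' w) -/(W' w).
  by rewrite addrC !addrA.
have E2 : (fun w => L / 2 * Q1 w + (2 * gamma)^-1 * Q2 w
      + kappa * (\sum_(i < n) (dot (u i w) (u i w)
      + beta ^+ 2 * omega * dot (v t i w) (v t i w)))
      + lambda * ((1 - alpha) * Q1 w)) =
    (fun w => (L / 2 + lambda * (1 - alpha)) * Q1 w + (2 * gamma)^-1 * Q2 w
      + kappa * (\sum_(i < n) (dot (u i w) (u i w)
      + beta ^+ 2 * omega * dot (v t i w) (v t i w)))).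
  apply/funext => w; move: (Q1 w) (Q2 w) (\sum_(i < n) _) => q1 q2 S; ring.
rewrite E1; apply: (mean_le_trans h1); rewrite E2; apply: (mean_le_trans h2).
apply: mean_le_pointwise; first by case: h2.
  by apply: nonneg_rvD => //; exact: nonneg_rvZ.
move=> w; rewrite sqrrN.
exact: (lyapunov_step n_gt0 fE L_gt0 M_gt0 f_smooth fi_smooth fi_convex
  xstar_min alpha_gt0 alpha_le1 gamma_gt0 omega_ge0 gamma_L gamma_M betaE
  (erefl lambda) (erefl kappa)).
Qed.

(** V_0 plus half of the initial gap; the lambda term is zero because w_0 = x_0. *)
Let initial : R := (2 * gamma)^-1 * dot (x0 - xstar) (x0 - xstar)
  + kappa * (\sum_(i < n)
      dot (h0 i - gradient (fi i) xstar) (h0 i - gradient (fi i) xstar))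
  + 2^-1 * (f x0 - f xstar).

(** Each new gap is split in halves: one joins the sum, the other feeds the next step. *)
Lemma telescoped_mean T :
  mean_le P (fun w => lyapunov T w + 2^-1 * gap T w
               + 2^-1 * \sum_(1 <= t < T.+1) gap t w)
            (fun=> initial).
Proof.
have nsum T' : nonneg_rv (fun w => 2^-1 * \sum_(1 <= t < T'.+1) gap t w).
  by apply: nonneg_rvZ => //; exact: nonneg_rv_sum.
elim: T => [|T ih].
  rewrite (_ : (fun w => _) = fun=> initial).
    apply: mean_le_refl; split=> // w; apply: addr_ge0; first apply: addr_ge0.
    - by apply: mulr_ge0 => //; exact: dot_ge0.
    - by apply: mulr_ge0 => //; apply: sumr_ge0 => i _; exact: dot_ge0.
    - by rewrite mulr_ge0// subr_ge0.
  apply/funext => w; rewrite big_geq// mulr0 addr0 /lyapunov.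
  by rewrite [wt 0 w - _]subrr dot0l mulr0 addr0.
rewrite (_ : (fun w => _) = fun w => (lyapunov T.+1 w + gap T.+1 w)
    + 2^-1 * \sum_(1 <= t < T.+1) gap t w).
  apply: mean_le_trans ih.
  apply: mean_leD; [exact: lyapunov_mean_step|exact: mean_le_refl].
apply/funext => w; rewrite big_nat_recr//=.
by move: (lyapunov _ w) (gap T.+1 w) (\sum_(1 <= t < T.+1) _) => l g s; lra.
Qed.

Lemma average_iterate_mean T : (0 < T)%N ->
  mean_le P (fun w => f (T%:R^-1 *: \sum_(1 <= t < T.+1) xt t w) - f xstar)
            (fun=> 2 / T%:R * initial).
Proof.
move=> T0; have TR : 0 < T%:R :> R by rewrite ltr0n.
have T2 : 0 <= 2 / T%:R :> R by rewrite divr_ge0.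
apply: mean_le_trans (mean_leZ T2 (telescoped_mean T)).
have [nlhs _ _] := telescoped_mean T.
apply: mean_le_pointwise; last 1 first.
- move=> w.
  have := first_order_jensen (xt ^~ w) T0
    (first_order_convex_average n_gt0 fE fi_diff fi_convex).
  set m := f _ => mle.
  have : m - f xstar <= T%:R^-1 * \sum_(1 <= t < T.+1) gap t w.
    rewrite sumrB sumr_const_nat subn1/= mulrBr -[f xstar *+ T]mulr_natl.
    by rewrite mulrA mulVf ?mul1r ?lerD2r// gt_eqF.
  move=> /le_trans; apply; rewrite -mulrA mulrCA; apply: ler_wpM2l.
    by rewrite invr_ge0 ltW.
  have [_ /(_ w) g0] := nonneg_gap T; have [_ /(_ w) l0] := nonneg_lyapunov T.
  lra.
- split=> [|w]; last by rewrite subr_ge0.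
  apply: measurable_funB => //.
  apply: (measurableT_comp (measurable_smooth f_smooth)).
  apply: (measurable_rVZ _ (X := fun w => \sum_(1 <= t < T.+1) xt t w)).
  apply: (@measurable_rV_sum _ _ _ _ _ _ xpredT) => t.
  by have [mx _ _] := state_measurable t; exact: (measurable_past Gm mx).
- exact: nonneg_rvZ.
Qed.

End diana_process.

(** * The rate under the stated stepsize condition *)

Unset Implicit Arguments.
Set Strict Implicit.
Set Printing Implicit Defensive.

Theorem theoremF2 (R : realType) (d n : nat) (n_gt0 : (0 < n)%N)
    (f : 'rV[R]_d -> R) (fi : 'I_n -> 'rV[R]_d -> R)
    (fE : forall x, f x = n%:R^-1 * \sum_(i < n) fi i x)
    (fi_diff : forall i x, differentiable (fi i) x)
    (L Lmax : R) (Li : 'I_n -> R)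
    (f_smooth : smoothness_constant L f)
    (fi_smooth : forall i, smoothness_constant (Li i) (fi i))
    (LmaxE : Lmax = \big[Num.max/0]_(i < n) Li i)
    (fi_convex : forall i, convex_function [set: 'rV[R]_d] (fi i))
    (xstar : 'rV[R]_d) (xstar_min : forall x, f xstar <= f x)
    (omega alpha : R) (omega_ge0 : 0 <= omega)
    (alpha_gt0 : 0 < alpha) (alpha_le1 : alpha <= 1)
    (CD : 'I_n -> stochastic_map R d) (CP : stochastic_map R d)
    (CD_unbiased : forall i, unbiased_compressor omega (CD i))
    (CP_contractive : contractive_compressor alpha CP)
    (disp : measure_display) (Omega : measurableType disp)
    (P : probability Omega R)
    (xiD : nat -> forall i : 'I_n, {mfun Omega >-> seed (CD i)})
    (xiP : nat -> {mfun Omega >-> seed CP})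
    (draws : independent_draws P xiD xiP)
    (x0 : 'rV[R]_d) (h0 : 'I_n -> 'rV[R]_d)
    (beta gamma : R) (betaE : beta = (omega + 1)^-1) (gamma_gt0 : 0 < gamma)
    (gamma_le : (gamma%:E <= Order.min
       (n%:R%:E / (160 * omega * Lmax)%:E)
       (alpha%:E / (100 * L)%:E))%E)
    (T : nat) (T_gt0 : (0 < T)%N) :
  let x t w := st_x (diana gamma beta fi xiD xiP x0 h0 t w) in
  ('E_P[fun w => f (T%:R^-1 *: \sum_(1 <= t < T.+1) x t w)%R] - (f xstar)%:E
   <= ((gamma * T%:R)^-1 * enorm (x0 - xstar) ^+ 2
       + (f x0 - f xstar) / T%:R
       + 16 * gamma * omega * (omega + 1) / (T%:R * n%:R ^+ 2)
         * \sum_(i < n) enorm (h0 i - gradient (fi i) xstar) ^+ 2)%:E)%E.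
Proof.
cbv zeta.
have [L0 fL _] := f_smooth.
have [gamma_Lmax gamma_L] : 160 * omega * Lmax * gamma <= n%:R
    /\ 100 * L * gamma <= alpha.
  have Lmax0 : 0 <= Lmax.
    by rewrite LmaxE; elim/big_ind : _ => // [u w u0 w0|i _];
      [rewrite le_max u0|case: (fi_smooth i)].
  move: gamma_le; rewrite le_min => /andP[h1 h2].
  by split; apply: le_mul_of_ereal_div => //; rewrite ?mulr_ge0// ltW.
(* L may be 0, whereas the smoothness lemmas take steps of length 1/L. [L'] is the largest constant
   that the stepsize allows, hence positive and at least L. *)
pose L' := alpha / (100 * gamma).
have L'0 : 0 < L' by rewrite divr_gt0// mulr_gt0.
have fL' : smooth_with L' f.
  apply: smooth_le fL _; rewrite ler_pdivlMr ?mulr_gt0//.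
  by apply: le_trans gamma_L; lra.
have gamma_L' : 100 * L' * gamma <= alpha.
  rewrite le_eqVlt; apply/orP; left; apply/eqP.
  by rewrite /L'; field; rewrite gt_eqF.
(* Same device for the workers. For omega = 0 the stepsize does not constrain M, and any positive
   bound on [Lmax] serves. *)
have [M [M0 LM gamma_M]] : exists M, [/\ 0 < M, Lmax <= M &
    160 * omega * gamma * M <= n%:R].
  have n0 : 0 < n%:R :> R by rewrite ltr0n.
  move: omega_ge0; rewrite le_eqVlt => /orP[/eqP <-|o0].
    exists (Num.max Lmax 1); split; first by rewrite lt_max ltr01 orbT.
      by rewrite le_max lexx.
    by rewrite mulr0 !mul0r ltW.
  have og0 : 0 < 160 * omega * gamma by rewrite !mulr_gt0.
  exists (n%:R / (160 * omega * gamma)); split; first by rewrite divr_gt0.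
    by rewrite ler_pdivlMr//; apply: le_trans gamma_Lmax; lra.
  by rewrite mulrC divfK// gt_eqF.
have fiM i : smooth_with M (fi i).
  have [_ si _] := fi_smooth i; apply: smooth_le si _.
  by apply: le_trans LM; rewrite LmaxE; exact: le_bigmax.
have fic i : first_order_convex (fi i) by exact: convex_first_order.
have [m [iX mX] mle] := mean_le_cst (average_iterate_mean n_gt0 fE L'0 M0
  fL' fiM fic xstar_min omega_ge0 alpha_gt0 alpha_le1 CD_unbiased
  CP_contractive draws x0 h0 betaE gamma_gt0 gamma_L' gamma_M T_gt0).
have [_ mf] := has_meanD (conj iX mX) (has_mean_cst P (f xstar)).
rewrite unlock.
under eq_integral => w _ do rewrite -(subrK (f xstar) (f _)).
rewrite mf -EFinB addrK lee_fin; apply: le_trans mle _.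
rewrite enorm_sqr; under [in leRHS]eq_bigr do rewrite enorm_sqr.
rewrite le_eqVlt; apply/orP; left; apply/eqP.
move: (dot _ _) (\sum_(i < n) _) => r s.
by field; rewrite !pnatr_eq0 -!lt0n n_gt0 T_gt0 gt_eqF.
Qed.
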